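(* For every $B>1$ there exists an integer $r=r(B)$ with the following property: for every $n$ and every matrix $T\in M_n(\mathbb{C})$ whose columns all have norm $1$ and such that $\|T\|\le B$, there exists a partition $\{A_1,\dots,A_r\}$ of $\{1,2,\dots,n\}$ such that, for every $j=1,2,\dots,r$ and every choice of complex numbers $(a_i)_{i\in A_j}$, $$\Bigl\|\sum_{i\in A_j}a_iT(\mathbf{e}_i)\Bigr\|_2^2\ \ge\ \frac{7}{16}\sum_{i\in A_j}|a_i|^2 .$$
   Context: $M_n(\mathbb{C})$ is the algebra of complex $n\times n$ matrices acting on $\mathbb{C}^n$ with its Euclidean norm $\|\cdot\|_2$ and canonical basis $\mathbf{e}_1,\dots,\mathbf{e}_n$; $\|T\|$ is the operator norm. The columns of $T$ are the vectors $T(\mathbf{e}_i)$, and their norm is the Euclidean norm. Some of the sets $A_j$ of the partition are allowed to be empty. *)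

(* Defs.v *)
From mathcomp Require Import all_boot all_order all_algebra.
From mathcomp Require Import classical_sets reals.
From mathcomp Require Import complex.

Set Implicit Arguments.
Unset Strict Implicit.
Unset Printing Implicit Defensive.

Import Order.TTheory GRing.Theory Num.Theory.

Local Open Scope ring_scope.

(* The norm `|z| of R[i] takes its values in R[i]; [Normc.normc z] is the
   modulus of z as an element of R. *)
Definition l2norm (R : realType) (n : nat) (x : 'cV[R[i]]_n) : R :=
  Num.sqrt (\sum_(i < n) Normc.normc (x i 0) ^+ 2).

(* The set below is nonempty (x = 0) and bounded above, so the total function
   [sup] returns its genuine least upper bound. *)
Definition opnorm (R : realType) (n : nat) (T : 'M[R[i]]_n) : R :=
  sup [set l2norm (T *m x) | x in [set x : 'cV[R[i]]_n | l2norm x <= 1]]%classic.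

Definition basis_vec (R : realType) (n : nat) (i : 'I_n) : 'cV[R[i]]_n :=
  delta_mx i 0.
Arguments basis_vec {R n} i.

(* The blocks are indexed and may be empty, unlike those of [finset.partition]. *)
Definition is_partition_family (n r : nat) (A : 'I_r -> {set 'I_n}) : Prop :=
  (\bigcup_(j < r) A j)%SET = [set: 'I_n]%SET
  /\ forall j k : 'I_r, j != k -> [disjoint A j & A k].

(* Main.v *)
Require Import Defs.
From mathcomp Require Import boolp classical_sets reals complex.
From mathcomp Require Import all_boot all_order all_algebra.
From mathcomp Require Import ring lra.

(* The conjecture is equivalent to Kadison-Singer; the proof is an elementary,
   real-variable version of the method of Marcus, Spielman and Srivastava.

   With G = T^* T, take the product over r copies of the multiaffine polynomial
   det (diag(w) + G).  Deriving it along all variables outside a set S gives the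
   product of the principal minors of diag(w) + G on the slices of S, so a paving
   is a choice of one copy (i, l) for each i such that the resulting polynomial
   stays positive down to w = c with c <= - 7/16.  All polynomials involved are
   multiaffine and satisfy the Rayleigh inequalities f d_ij f <= d_i f d_j f on
   the whole of R^n, which for multiaffine polynomials is real stability (Branden);
   this replaces complex zeros, interlacing families and mixed characteristic
   polynomials.

   The basic operation merges two variables u, z into their sum: a u z + b u +
   c z + d becomes a (u + z) + b + c = d_u f + d_z f.  It preserves the Rayleigh
   inequalities.  Going forward, all copies of each i are merged, and the barriers
   d_j f / f do not increase although the merged variable is moved down by xi, with
   xi the distance to the larger root on the diagonal; 1 / xi telescopes, so by the
   AM-HM inequality the total shift per copy is at least (r / (r + 1))^2 / alpha,
   alpha being the initial barrier.  Going backward, each merge is undone: since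
   d_u f + d_z f > 0, one of the two summands is positive, and the Rayleigh
   inequality propagates its positivity to all its derivatives. *)

Set Implicit Arguments.
Unset Strict Implicit.
Unset Printing Implicit Defensive.

Import Order.TTheory GRing.Theory Num.Theory.

Local Open Scope ring_scope.


(** * Scalar inequalities *)

Section Quadratic.
Variable R : realFieldType.
Implicit Types a b c e : R.

Lemma quadratic_ge0_lead a b c :
  (forall x, 0 <= a + b * x + c * x ^+ 2) -> 0 <= c.
Proof.
move=> H; rewrite leNgt; apply/negP => c0.
have a0 : 0 <= a by have := H 0; rewrite expr0n /= !mulr0 !addr0.
have ac : 0 <= - a / c by rewrite mulNr -mulrN -invrN divr_ge0 // oppr_ge0 ltW.
(* The values at two opposite points add up to twice [a + c * (1 - q) ^+ 2], which is negative
   because [c < 0] and [q = a / c <= 0]. *)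
have := H (1 - a / c); have := H (- (1 - a / c)).
have e : c * (a / c) = a by rewrite mulrC divfK // lt_eqF.
move: ac e; rewrite mulNr; set q := a / c => ac e H1 H2.
have : 0 <= a + c * (1 - q) ^+ 2 by nra.
nra.
Qed.

Lemma quadratic_ge0_disc a b c :
  (forall x, 0 <= a + b * x + c * x ^+ 2) -> b ^+ 2 <= 4 * a * c.
Proof.
move=> H; have := quadratic_ge0_lead H; rewrite le_eqVlt => /predU1P[c0|c0].
  rewrite -c0 mulr0; have [->|b0] := eqVneq b 0; first by rewrite expr0n.
  have := H (- (a + 1) / b); rewrite -c0 mul0r addr0 mulrC divfK //.
  lra.
have := H (- b / (2 * c)).
have -> : a + b * (- b / (2 * c)) + c * (- b / (2 * c)) ^+ 2
   = (4 * a * c - b ^+ 2) / (4 * c) by field; rewrite gt_eqF.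
by rewrite pmulr_lge0 ?invr_gt0 ?mulr_gt0 // subr_ge0.
Qed.

Lemma quadratic_disc_ge0 a b c : 0 <= a -> 0 <= c -> b ^+ 2 <= 4 * a * c ->
  forall x, 0 <= a + b * x + c * x ^+ 2.
Proof.
move=> a0; rewrite le_eqVlt => /predU1P[<-|c0] d x.
  have b0 : b = 0.
    by apply/eqP; rewrite -sqrf_eq0 eq_le sqr_ge0 andbT; move: d; rewrite mulr0.
  by rewrite b0 !mul0r !addr0.
have e : 0 <= (4 * c) * (a + b * x + c * x ^+ 2).
  have -> : (4 * c) * (a + b * x + c * x ^+ 2)
    = (2 * c * x + b) ^+ 2 + (4 * a * c - b ^+ 2) by ring.
  by rewrite addr_ge0 ?sqr_ge0 ?subr_ge0.
by move: e; rewrite pmulr_rge0 // mulr_gt0.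
Qed.

End Quadratic.

(** * Multiaffine functions and the Rayleigh inequalities *)

Section Multiaffine.
Variables (R : rcfType) (J : finType).
Implicit Types (f g h : (J -> R) -> R) (w x y : J -> R) (i j k u z : J).

Definition upd w i (t : R) : J -> R := fun k => if k == i then t else w k.

(* For multiaffine f this difference is the partial derivative. *)
Definition pd i f : (J -> R) -> R := fun w => f (upd w i 1) - f (upd w i 0).

Definition multiaffine f :=
  forall i w t, f (upd w i t) = f (upd w i 0) + t * pd i f w.

Lemma upd_at w i t : upd w i t i = t.
Proof. by rewrite /upd eqxx. Qed.

Lemma upd_id w i : upd w i (w i) = w.
Proof. by apply/funext => k; rewrite /upd; case: eqP => [->|]. Qed.

Lemma upd_upd w i s t : upd (upd w i s) i t = upd w i t.
Proof. by apply/funext => k; rewrite /upd; case: eqP. Qed.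

Lemma updC w i j s t : i != j -> upd (upd w i s) j t = upd (upd w j t) i s.
Proof.
move=> ij; apply/funext => k; rewrite /upd.
by case: (k =P i) => [->|//]; rewrite (negPf ij).
Qed.

Lemma upd_neq w i t k : k != i -> upd w i t k = w k.
Proof. by rewrite /upd => /negPf ->. Qed.

Lemma pd_upd i f w t : pd i f (upd w i t) = pd i f w.
Proof. by rewrite /pd !upd_upd. Qed.

Lemma multiaffineE f i w t : multiaffine f ->
  f (upd w i t) = f w + (t - w i) * pd i f w.
Proof.
by move=> mf; have := mf i w (w i); rewrite upd_id => ->; rewrite (mf i w t); ring.
Qed.

Lemma pdC i j f : pd i (pd j f) = pd j (pd i f).
Proof.
have [->//|ij] := eqVneq i j.
apply/funext => w; rewrite /pd !(updC _ _ _ ij); ring.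
Qed.

Lemma pd_cst i (c : R) : pd i (fun=> c) = fun=> 0.
Proof. by apply/funext => w; rewrite /pd subrr. Qed.

Lemma pd_pd i f : pd i (pd i f) = fun=> 0.
Proof. by apply/funext => w; rewrite {1}/pd !pd_upd subrr. Qed.

Lemma pdD i f g : pd i (fun w => f w + g w) = fun w => pd i f w + pd i g w.
Proof. by apply/funext => w; rewrite /pd; ring. Qed.

Lemma multiaffineD f g : multiaffine f -> multiaffine g ->
  multiaffine (fun w => f w + g w).
Proof. by move=> mf mg i w t; rewrite pdD (mf i) (mg i); ring. Qed.

Lemma pd_fix j f i c : j != i ->
  pd j (fun w => f (upd w i c)) = fun w => pd j f (upd w i c).
Proof.
by move=> ji; apply/funext => w; rewrite /pd !(updC _ _ _ ji).
Qed.

Lemma pd_fix_same f i c : pd i (fun w => f (upd w i c)) = fun=> 0.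
Proof. by apply/funext => w; rewrite /pd !upd_upd subrr. Qed.

Lemma multiaffine_fix f i c : multiaffine f -> multiaffine (fun w => f (upd w i c)).
Proof.
move=> mf j w t; have [->|ji] := eqVneq j i.
  by rewrite pd_fix_same !upd_upd mulr0 addr0.
by rewrite pd_fix // !(updC _ _ _ ji) mf.
Qed.

Lemma multiaffine_pd i f : multiaffine f -> multiaffine (pd i f).
Proof.
move=> mf j w t; have [->|ij] := eqVneq j i.
  by rewrite pd_pd !pd_upd mulr0 addr0.
by rewrite /pd !(updC _ _ _ ij) (mf j (upd w i 1)) (mf j (upd w i 0)) /pd; ring.
Qed.

Definition rayleigh f :=
  forall i j w, i != j -> f w * pd i (pd j f) w <= pd i f w * pd j f w.

Definition mstable f := multiaffine f /\ rayleigh f.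

(** As a function of the coordinate [i] alone, the Rayleigh difference of [f] for [(j, k)] is a
    quadratic that is nonnegative everywhere. Its leading coefficient is the Rayleigh difference of
    [pd i f]. *)
Lemma mstable_pd i f : mstable f -> mstable (pd i f).
Proof.
move=> [mf rf]; split; first exact: multiaffine_pd.
move=> j k w jk.
have [->|ji] := eqVneq j i; first by rewrite (pdC i k) !pd_pd pd_cst mulr0 mul0r.
have [->|ki] := eqVneq k i; first by rewrite !pd_pd pd_cst mulr0 mulr0.
rewrite -subr_ge0.
pose w0 := upd w i 0.
apply: (@quadratic_ge0_lead _ (pd j f w0 * pd k f w0 - f w0 * pd j (pd k f) w0)
   (pd j (pd i f) w * pd k f w0 + pd j f w0 * pd k (pd i f) w
    - f w0 * pd j (pd k (pd i f)) w - pd i f w * pd j (pd k f) w0)) => t.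
have := rf j k (upd w i t) jk; rewrite -subr_ge0.
have mj := multiaffine_pd j mf; have mk := multiaffine_pd k mf.
have mjk := multiaffine_pd j mk.
rewrite (mf i) (mj i) (mk i) (mjk i) -/w0 (pdC i j) (pdC i k) (pdC i j) (pdC i k).
by congr (0 <= _); ring.
Qed.

End Multiaffine.

(** A substitute for a limit argument: if [q] were negative at 0, it would be negative on an
    interval to the right of 0, and [p] would vanish on that whole interval. *)
Lemma poly_ge0_of_generic (R : realFieldType) (p q : {poly R}) :
  p != 0 -> (forall e, p.[e] != 0 -> 0 <= q.[e]) -> 0 <= q.[0].
Proof.
move=> p0 H; rewrite leNgt; apply/negP => q0.
have /factor_theorem[r qr] : root (q - q.[0]%:P) 0.
  by rewrite rootE !hornerE subrr.
have qE x : q.[x] = q.[0] + x * r.[x].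
  have := congr1 (fun s : {poly R} => s.[x]) qr.
  by rewrite !hornerE => /eqP; rewrite subr_eq => /eqP ->; rewrite subr0; ring.
have [M HM] := poly_disk_bound r 1.
have M0 : 0 <= M by apply: le_trans (HM 0 _); rewrite ?normr0.
(* Since [r] is bounded by [M] on the unit disk, [q] stays negative on the interval from 0 to
   [x0]. *)
pose x0 := Num.min 1 (- q.[0] / (2 * (M + 1))).
have M1 : 0 < 2 * (M + 1) by rewrite mulr_gt0 // ltr_wpDl.
have x00 : 0 < x0 by rewrite lt_min ltr01 divr_gt0 ?oppr_gt0.
have px x : 0 < x -> x <= x0 -> root p x.
  move=> xp xx0; rewrite rootE; apply/negP => /negP /H; rewrite qE.
  have x1 : x <= 1 by apply: le_trans xx0 _; rewrite ge_min lexx.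
  have xM : x * (2 * (M + 1)) <= - q.[0].
    by rewrite -ler_pdivlMr //; apply: le_trans xx0 _; rewrite ge_min lexx orbT.
  have := HM x; rewrite gtr0_norm // => /(_ x1); rewrite ler_norml => /andP[_ rM].
  by apply/negP; rewrite -ltNge; nra.
(* These are [size p] distinct roots of [p], one more than a nonzero polynomial can have. *)
pose s := [seq x0 / k.+1%:R | k <- iota 0 (size p)].
have : (size s < size p)%N.
  apply: (max_poly_roots p0).
    apply/allP => _ /mapP[k _ ->]; apply: px; first by rewrite divr_gt0 ?ltr0n.
    by rewrite ler_pdivrMr ?ltr0n // ler_peMr ?(ltW x00) // ler1n.
  rewrite map_inj_uniq ?iota_uniq // => a b /(mulfI (lt0r_neq0 x00)) /invr_inj.
  by move/eqP; rewrite eqr_nat => /eqP [].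
by rewrite size_map size_iota ltnn.
Qed.

(** * Mixed derivatives and positivity on shifted orthants *)

Section Above.
Variables (R : rcfType) (J : finType).
Implicit Types (f g h : (J -> R) -> R) (w x y : J -> R) (i j k u z : J).
Implicit Types (S T V : {set J}).

(** The coordinates are moved one at a time, each move adding a multiple of ['X * q]. This makes
    [poly_ge0_of_generic] available along lines. *)
Lemma multiaffine_line f w v : multiaffine f ->
  exists p : {poly R}, forall e, f (fun j => w j + e * v j) = p.[e].
Proof.
suff H (s : seq J) : uniq s -> forall f, multiaffine f ->
    exists p : {poly R}, forall e,
      f (fun j => if j \in s then w j + e * v j else w j) = p.[e].
  move=> mf; have [p Hp] := H (enum J) (enum_uniq J) f mf.
  by exists p => e; rewrite -Hp; congr f; apply/funext => j; rewrite mem_enum.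
elim: s => [_ f1 mf|i s IH /= /andP[gs us] f1 mf].
  by exists (f1 w)%:P => e; rewrite hornerC.
have [p Hp] := IH us _ mf; have [q Hq] := IH us _ (multiaffine_pd i mf).
exists (p + v i *: ('X * q)) => e; rewrite hornerD hornerZ hornerM hornerX -Hp -Hq.
set w' := fun j => if j \in s then _ else _.
have -> : (fun j => if j \in i :: s then w j + e * v j else w j)
   = upd w' i (w i + e * v i).
  apply/funext => j; rewrite /upd /w' inE.
  by case: eqP => [->|].
have w'i : w' i = w i by rewrite /w' (negPf gs).
rewrite multiaffineE // w'i; ring.
Qed.

Definition pds S f : (J -> R) -> R := foldr (@pd R J) f (enum S).

Lemma foldr_pdC s i f : foldr (@pd R J) (pd i f) s = pd i (foldr (@pd R J) f s).
Proof. by elim: s => //= j s ->; rewrite pdC. Qed.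

Lemma foldr_pd_rem s i f : i \in s ->
  foldr (@pd R J) f s = pd i (foldr (@pd R J) f (rem i s)).
Proof.
elim: s => //= j s IH; rewrite inE; have [->//|ij /=] := eqVneq j i.
by move=> /IH ->; rewrite pdC.
Qed.

Lemma perm_foldr_pd s t f : perm_eq s t ->
  foldr (@pd R J) f s = foldr (@pd R J) f t.
Proof.
elim: s t => [|i s IH] t; first by move/perm_size; case: t.
move=> st; have it : i \in t by rewrite -(perm_mem st) inE eqxx.
rewrite (foldr_pd_rem _ it) /= (IH (rem i t)) //.
by rewrite -(perm_cons i) (permPl st) perm_to_rem.
Qed.

Lemma pds0 f : pds set0 f = f.
Proof. by rewrite /pds enum_set0. Qed.

Lemma pds_pd S i f : pds S (pd i f) = pd i (pds S f).
Proof. exact: foldr_pdC. Qed.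

Lemma pdsU1 S i f : i \notin S -> pds (i |: S) f = pd i (pds S f).
Proof.
move=> iS; rewrite /pds -[RHS]/(foldr (@pd R J) f (i :: enum S)).
apply: perm_foldr_pd; apply: uniq_perm; rewrite /= ?enum_uniq ?mem_enum ?iS //.
by move=> j; rewrite !inE !mem_enum !inE.
Qed.

Lemma pdsD1 S i f : i \in S -> pds S f = pd i (pds (S :\ i) f).
Proof. by move=> iS; rewrite -pdsU1 ?setD1K // !inE eqxx. Qed.

Lemma pd_pds_in S i f : i \in S -> pd i (pds S f) = fun=> 0.
Proof. by move=> iS; rewrite (pdsD1 _ iS) pd_pd. Qed.

Lemma set_ind_U1 (P : {set J} -> Prop) : P set0 ->
  (forall i S, i \notin S -> P S -> P (i |: S)) -> forall S, P S.
Proof.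
move=> P0 P1 S; elim: {S}_.+1 {-2}S (ltnSn #|S|) => // n IH S.
have [->//|[i iS]] := set_0Vmem S.
rewrite (cardsD1 i) iS add1n ltnS => Sn.
by rewrite -(setD1K iS); apply: P1; rewrite ?inE ?eqxx //; apply: IH.
Qed.

Lemma pdsU S T f : [disjoint S & T] -> pds (S :|: T) f = pds S (pds T f).
Proof.
elim/set_ind_U1: S => [|i S iS IH]; first by rewrite set0U pds0.
move=> dU.
have iT : i \notin T by rewrite (disjointFr dU) // !inE eqxx.
have dST : [disjoint S & T] by apply: disjointWl dU; apply: subsetUr.
rewrite -setUA pdsU1 ?inE ?negb_or ?iS //.
by rewrite IH // -pdsU1.
Qed.

Lemma mstable_pds S f : mstable f -> mstable (pds S f).
Proof.
move=> sf; elim/set_ind_U1: S => [|i S iS IH]; first by rewrite pds0.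
by rewrite pdsU1 //; apply: mstable_pd.
Qed.

(* By Taylor's formula, f is positive on x plus the nonnegative orthant. *)
Definition above V f x := forall S, S \subset V -> 0 < pds S f x.

Lemma above_gt0 V f x : above V f x -> 0 < f x.
Proof. by move=> /(_ set0 (sub0set _)); rewrite pds0. Qed.

Lemma aboveS V V' f x : V' \subset V -> above V f x -> above V' f x.
Proof. by move=> sV H S /subset_trans/(_ sV); apply: H. Qed.

Lemma above_pd V f x i : i \in V -> above V f x -> above (V :\ i) (pd i f) x.
Proof.
move=> iV H S sS; rewrite pds_pd -pdsU1.
  by apply: H; rewrite subUset sub1set iV (subset_trans sS) // subD1set.
by apply/negP => /(subsetP sS); rewrite !inE eqxx.
Qed.

Lemma above_pd_gt0 V f x i : i \in V -> above V f x -> 0 < pd i f x.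
Proof. by move=> iV /(above_pd iV) /above_gt0. Qed.

Lemma above_pd_upd V f x i t :
  above V (pd i f) (upd x i t) <-> above V (pd i f) x.
Proof.
by split=> H S /H; rewrite pds_pd pd_upd.
Qed.

(* The Rayleigh inequality for (i, j) bounds pd j h from below by
   h * pd i (pd j h) / pd i h. *)
Lemma above_extend V h x i : mstable h -> above (V :\ i) (pd i h) x ->
  0 < h x -> above V h x.
Proof.
move=> sh H h0; elim/set_ind_U1 => [|j S jS IH]; first by rewrite pds0.
rewrite subUset sub1set => /andP[jV SV]; have {IH}IH := IH SV.
have [iS|iS] := boolP (i \in j |: S).
  rewrite (pdsD1 _ iS) -pds_pd; apply: H.
  by apply: setSD; rewrite subUset sub1set jV.
move: (iS); rewrite !inE negb_or => /andP[ij iS'].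
have [_ rS] := mstable_pds S sh.
have := rS i j x ij; rewrite -(pdsU1 _ jS) -!pds_pd => le1.
have p1 : 0 < pds S (pd i h) x.
  by apply: H; apply/subsetP => k kS; rewrite !inE (subsetP SV) // andbT;
    apply: contraNneq iS' => <-.
have p2 : 0 < pds (j |: S) (pd i h) x.
  apply: H; apply/subsetP => k; rewrite !inE => /predU1P[->|kS].
    by rewrite eq_sym ij jV.
  by rewrite (subsetP SV) // andbT; apply: contraNneq iS' => <-.
have : 0 < pds S (pd i h) x * pds (j |: S) h x.
  by apply: lt_le_trans le1; rewrite mulr_gt0.
by rewrite pmulr_rgt0.
Qed.

(** Raising [u] adds to each mixed derivative a nonnegative multiple of its derivative along [u],
    which is either zero or again one of the positive mixed derivatives. *)
Lemma above_raise V f x u t : mstable f -> u \in V -> x u <= t ->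
  above V f x -> above V f (upd x u t).
Proof.
move=> sf uV xt H S SV; rewrite multiaffineE; last by have [] := mstable_pds S sf.
apply: ltr_wpDr; last exact: H.
have [uS|uS] := boolP (u \in S); first by rewrite pd_pds_in // mulr0.
apply: mulr_ge0; first by rewrite subr_ge0.
rewrite -pdsU1 // ltW //; apply: H.
by rewrite subUset sub1set uV.
Qed.

(** It suffices to check the Rayleigh inequalities off the zero set of [h]: on the line from [w] to
    [x0], [h] is a nonzero polynomial, so the inequality extends to [w] itself. *)
Lemma mstable_of_generic f h x0 : multiaffine f -> multiaffine h -> h x0 != 0 ->
  (forall i j w, i != j -> h w != 0 ->
     f w * pd i (pd j f) w <= pd i f w * pd j f w) -> mstable f.
Proof.
move=> mf mh h0 H; split=> // i j w ij.
pose v k := x0 k - w k.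
have mi := multiaffine_pd i mf; have mj := multiaffine_pd j mf.
have mij := multiaffine_pd i mj.
have [p Hp] := multiaffine_line w v mh.
have [p1 H1] := multiaffine_line w v mf.
have [p2 H2] := multiaffine_line w v mi.
have [p3 H3] := multiaffine_line w v mj.
have [p4 H4] := multiaffine_line w v mij.
have w0 : (fun k => w k + 0 * v k) = w by apply/funext => k; rewrite mul0r addr0.
have w1 : (fun k => w k + 1 * v k) = x0 by apply/funext => k; rewrite /v; ring.
have : 0 <= (p2 * p3 - p1 * p4).[0].
  apply: (@poly_ge0_of_generic _ p).
    by apply: contraNneq h0 => p0; rewrite -w1 Hp p0 horner0.
  move=> e; rewrite -Hp => he; rewrite !hornerE -H1 -H2 -H3 -H4 subr_ge0.
  exact: H.
by rewrite !hornerE -H1 -H2 -H3 -H4 w0 subr_ge0.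
Qed.

End Above.

(** * Merging two variables *)

Section ScalarInequalities.
Variable R : rcfType.
Implicit Types a b c e : R.

Lemma ler_of_sqr a b : 0 <= b -> a ^+ 2 <= b ^+ 2 -> a <= b.
Proof. by move=> b0 ab; rewrite leNgt; apply/negP => ba; nra. Qed.

(* Centring s at the zero of b + s * a turns each hypothesis into a quadratic
   form X * Y + Z * t + D * t ^+ 2 whose discriminant condition is stable
   under addition of (X, Y, Z). *)
Lemma rayleigh_pencilD a a1 a2 a12 b b1 b2 b12 c c1 c2 c12 : a != 0 ->
  b * a1 <= a * b1 -> b * a2 <= a * b2 -> c * a1 <= a * c1 -> c * a2 <= a * c2 ->
  (forall s, (b + s * a) * (b12 + s * a12) <= (b1 + s * a1) * (b2 + s * a2)) ->
  (forall s, (c + s * a) * (c12 + s * a12) <= (c1 + s * a1) * (c2 + s * a2)) ->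
  forall s, (b + c + s * a) * (b12 + c12 + s * a12)
         <= (b1 + c1 + s * a1) * (b2 + c2 + s * a2).
Proof.
move=> a0 hb1 hb2 hc1 hc2 Hb Hc s.
pose X b b1 := a * b1 - b * a1; pose Y b b2 := a * b2 - b * a2.
pose Z b b1 b2 b12 := a1 * Y b b2 + a2 * X b b1 - a * (a * b12 - b * a12).
pose D := a1 * a2 - a * a12.
have key b' b1' b2' b12' t :
    a ^+ 2 * ((b1' + (t - b') / a * a1) * (b2' + (t - b') / a * a2)
     - (b' + (t - b') / a * a) * (b12' + (t - b') / a * a12))
    = X b' b1' * Y b' b2' + Z b' b1' b2' b12' * t + D * t ^+ 2.
  by rewrite /Z /X /Y /D; field.
have pos b' b1' b2' b12' :
    (forall s, (b' + s * a) * (b12' + s * a12) <= (b1' + s * a1) * (b2' + s * a2)) ->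
    forall t, 0 <= X b' b1' * Y b' b2' + Z b' b1' b2' b12' * t + D * t ^+ 2.
  by move=> H t; rewrite -key mulr_ge0 ?sqr_ge0 // subr_ge0.
have db := quadratic_ge0_disc (pos _ _ _ _ Hb).
have dc := quadratic_ge0_disc (pos _ _ _ _ Hc).
have D0 := quadratic_ge0_lead (pos _ _ _ _ Hb).
have Xb : 0 <= X b b1 by rewrite subr_ge0.
have Yb : 0 <= Y b b2 by rewrite subr_ge0.
have Xc : 0 <= X c c1 by rewrite subr_ge0.
have Yc : 0 <= Y c c2 by rewrite subr_ge0.
have XD : X (b + c) (b1 + c1) = X b b1 + X c c1 by rewrite /X; ring.
have YD : Y (b + c) (b2 + c2) = Y b b2 + Y c c2 by rewrite /Y; ring.
have ZD : Z (b + c) (b1 + c1) (b2 + c2) (b12 + c12) = Z b b1 b2 b12 + Z c c1 c2 c12.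
  by rewrite /Z XD YD; ring.
have := key (b + c) (b1 + c1) (b2 + c2) (b12 + c12) (s * a + (b + c)).
rewrite XD YD ZD addrK mulfK // => keyD.
rewrite -subr_ge0 -(@pmulr_rge0 _ (a ^+ 2)) ?exprn_even_gt0 // keyD.
clear key pos keyD; move: (X b b1) (X c c1) (Y b b2) (Y c c2) (Z b b1 b2 b12) (Z c c1 c2 c12) D
  Xb Xc Yb Yc db dc D0 => p q p' q' y z d p0 q0 p'0 q'0 dy dz d0.
apply: quadratic_disc_ge0; rewrite ?mulr_ge0 ?addr_ge0 //.
(* The cross term is controlled by multiplying the two discriminant bounds; what is lost is
   [4 * d ^+ 2 * (p * q' - q * p') ^+ 2]. *)
have yz : y * z <= 2 * d * (p * q' + q * p').
  apply: ler_of_sqr; first by rewrite !mulr_ge0 ?addr_ge0 ?mulr_ge0.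
  have h1 : y ^+ 2 * z ^+ 2 <= (4 * (p * p') * d) * (4 * (q * q') * d).
    by apply: ler_pM; rewrite ?sqr_ge0.
  have h2 : 0 <= d ^+ 2 * (p * q' - q * p') ^+ 2 by rewrite mulr_ge0 ?sqr_ge0.
  by rewrite exprMn; apply: (le_trans h1); rewrite -subr_ge0;
     apply: le_trans (mulr_ge0 (ler0n _ 4) h2) _;
     rewrite le_eqVlt; apply/orP; left; apply/eqP; ring.
nra.
Qed.

(** The roots of [a * e ^+ 2 + b * e + c] are [- r] and [- s]; [r] is thus the distance from 0 to
    the larger one. *)
Lemma quadratic_roots a b c : 0 < a -> 0 < b -> 0 < c -> 4 * a * c <= b ^+ 2 ->
  exists r s, [/\ 0 < r, r <= s, b = a * (r + s) & c = a * r * s].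
Proof.
move=> a0 b0 c0 d; pose q := Num.sqrt (b ^+ 2 - 4 * a * c).
have q0 : 0 <= q by apply: sqrtr_ge0.
have q2 : q ^+ 2 = b ^+ 2 - 4 * a * c by rewrite sqr_sqrtr // subr_ge0.
have ac : 0 < 4 * a * c by rewrite !mulr_gt0.
have qb : q < b by rewrite ltNge; apply/negP => bq; nra.
have aN := lt0r_neq0 a0.
exists ((b - q) / (2 * a)), ((b + q) / (2 * a)); split.
- by rewrite divr_gt0 ?mulr_gt0 // subr_gt0.
- by rewrite ler_pM2r ?invr_gt0 ?mulr_gt0 //; lra.
- by field.
have -> : a * ((b - q) / (2 * a)) * ((b + q) / (2 * a)) = (b ^+ 2 - q ^+ 2) / (4 * a).
  by field.
by rewrite q2; field.
Qed.

(* p is the value at the larger root of phi = e * (e + d) (shifted to e = 0) of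
   a quadratic whose Wronskian with phi is nonnegative; d = 0 is allowed. *)
Lemma wronskian_root_ge0 (p q r d : R) : 0 <= d ->
  (forall e, 0 < e ->
     (q + 2 * r * e) * (e ^+ 2 + d * e) <= (p + q * e + r * e ^+ 2) * (2 * e + d)) ->
  0 <= p.
Proof.
move=> d0 H; rewrite leNgt; apply/negP => p0.
(* After cancellation the hypothesis reads [0 <= p * d + 2 * p * e + (q - r * d) * e ^+ 2]. For
   [e = - p / m] the last term is at most [- p * e], so the right-hand side is negative. *)
pose m := `|q - r * d| + 1.
have m0 : 0 < m by rewrite ltr_wpDl.
pose e := - p / m; have e0 : 0 < e by rewrite divr_gt0 // oppr_gt0.
have em : e * m = - p by rewrite /e divfK // gt_eqF.
have mq : q - r * d <= m by rewrite (le_trans (ler_norm _)) // lerDl.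
have := H e e0.
have h : (q - r * d) * e ^+ 2 <= m * e ^+ 2 by rewrite ler_wpM2r // sqr_ge0.
have h2 : m * e ^+ 2 = - p * e by rewrite -em; ring.
have h3 : p * d <= 0 by rewrite mulr_le0_ge0 // ltW.
have h4 : p * e < 0 by rewrite pmulr_llt0.
nra.
Qed.

(** Cauchy-Schwarz in the form that lets the shifts of successive merges accumulate. *)
Lemma titu (u v p q : R) : 0 <= p -> 0 < q -> 0 < u -> 0 < v ->
  (p + q) ^+ 2 / (u + v) <= p ^+ 2 / u + q ^+ 2 / v.
Proof.
move=> p0 q0 u0 v0; rewrite ler_pdivrMr ?addr_gt0 // -subr_ge0.
have -> : (p ^+ 2 / u + q ^+ 2 / v) * (u + v) - (p + q) ^+ 2
   = (p * v - q * u) ^+ 2 / (u * v) by field; rewrite !gt_eqF.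
by rewrite divr_ge0 ?sqr_ge0 // mulr_ge0 // ltW.
Qed.

End ScalarInequalities.

Section Merge.
Variables (R : rcfType) (J : finType).
Implicit Types (f g h : (J -> R) -> R) (w x y : J -> R) (i j k u z : J).
Implicit Types (S T V : {set J}).

(* Writing f = a * u * z + b * u + c * z + d, merge u z f is the polynomial
   a * s + b + c in s = u + z, with s stored in the coordinate u. *)
Definition merge u z f : (J -> R) -> R := fun w => pd u f (upd w z 0) + pd z f w.

Lemma multiaffine_merge u z f : multiaffine f -> multiaffine (merge u z f).
Proof.
move=> mf; apply: multiaffineD; last exact: multiaffine_pd.
exact/(@multiaffine_fix _ _ (pd u f))/multiaffine_pd.
Qed.

Lemma pd_merge_l u z f : u != z -> pd u (merge u z f) = pd u (pd z f).
Proof.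
move=> uz; rewrite /merge pdD (pd_fix (pd u f)) // pd_pd.
by apply/funext => w; rewrite add0r.
Qed.

Lemma pd_merge_r u z f : pd z (merge u z f) = fun=> 0.
Proof.
rewrite /merge pdD (pd_fix_same (pd u f)) pd_pd.
by apply/funext => w; rewrite addr0.
Qed.

Lemma pd_merge j u z f : j != z -> pd j (merge u z f) = merge u z (pd j f).
Proof.
by move=> jz; rewrite /merge pdD (pd_fix (pd u f)) // !(pdC j).
Qed.

(** The point [w] corresponds to the value [w u + w z] of the merged variable, and the last term is
    the effect of moving away from it. *)
Lemma mergeE u z f w s : multiaffine f -> u != z ->
  merge u z f (upd w u s)
    = pd u f w + pd z f w + (s - w u - w z) * pd u (pd z f) w.
Proof.
move=> mf uz; rewrite /merge (updC _ _ _ uz) pd_upd.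
rewrite (multiaffineE _ _ _ (multiaffine_pd u mf)).
rewrite (multiaffineE _ _ _ (multiaffine_pd z mf)) (pdC z u); ring.
Qed.

Lemma multiaffine_diag u z f w t : multiaffine f -> u != z ->
  f (upd (upd w u (w u + t)) z (w z + t))
    = f w + t * (pd u f w + pd z f w) + t ^+ 2 * pd u (pd z f) w.
Proof.
move=> mf uz; rewrite (multiaffineE _ _ _ mf) upd_neq 1?eq_sym //.
rewrite (multiaffineE _ _ _ mf) (multiaffineE _ _ _ (multiaffine_pd z mf)); ring.
Qed.

(** Where [pd u (pd z f)] is nonzero, the inequalities for the merge follow from those of [pd u f]
    and [pd z f]; the remaining points are reached by genericity. *)
Lemma mstable_merge u z f x : u != z -> mstable f -> pd u (pd z f) x != 0 ->
  mstable (merge u z f).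
Proof.
move=> uz sf ax; have [mf rf] := sf.
apply: (@mstable_of_generic _ _ _ (pd u (pd z f)) x) => //.
- exact: multiaffine_merge.
- by do 2!apply: multiaffine_pd.
have [_ ru] := mstable_pd u sf; have [_ rz] := mstable_pd z sf.
(* If one of the two variables is [u], the inequality is the sum of the Rayleigh inequality of
   [pd u f] for [(z, k)] and that of [pd z f] for [(u, k)]. *)
have caseu k w : k != u -> k != z -> merge u z f w * pd u (pd k (merge u z f)) w
    <= pd u (merge u z f) w * pd k (merge u z f) w.
  move=> ku kz; rewrite pdC pd_merge_l // pd_merge // /merge.
  have zk : z != k by rewrite eq_sym.
  have uk : u != k by rewrite eq_sym.
  have := rz u k w uk; have := ru z k (upd w z 0) zk.
  rewrite !pd_upd (pdC z k) (pdC z u) (pdC u k (pd z f)) (pdC k u f) (pdC k z f).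
  by move=> h1 h2; rewrite [leLHS]mulrDl [leRHS]mulrDr; apply: lerD.
move=> i j w ij aw.
have [iz|iz] := eqVneq i z; first by rewrite iz pdC !pd_merge_r pd_cst mulr0 mul0r.
have [jz|jz] := eqVneq j z; first by rewrite jz !pd_merge_r pd_cst !mulr0.
have [iu|iu] := eqVneq i u; first by rewrite iu; apply: caseu; rewrite // -iu eq_sym.
have [ju|ju] := eqVneq j u; first by rewrite ju pdC mulrC [leRHS]mulrC mulrC; apply: caseu.
have wE : w = upd w u (w u) by rewrite upd_id.
have e h : multiaffine h -> merge u z h w
   = pd u h (upd w z 0) + pd z h (upd w u 0) + w u * pd u (pd z h) w.
  move=> mh; rewrite /merge -{2}[w](upd_id _ u) (multiaffine_pd z mh u w (w u)).
  by rewrite addrA.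
have mi := multiaffine_pd i mf; have mj := multiaffine_pd j mf.
have mij := multiaffine_pd i mj.
rewrite !pd_merge // !e //.
have zi : z != i by rewrite eq_sym.
have zj : z != j by rewrite eq_sym.
have ui : u != i by rewrite eq_sym.
have uj : u != j by rewrite eq_sym.
(* Here [a] is [pd u (pd z f)], [b] is [pd u f] at [z = 0], [c] is [pd z f] at [u = 0], and the
   pencil parameter is the merged variable. *)
apply: rayleigh_pencilD => //.
- by have := ru z i (upd w z 0) zi;
    rewrite !pd_upd (pdC z i) (pdC z u) (pdC i u f) (pdC i u) (pdC i z).
- by have := ru z j (upd w z 0) zj;
    rewrite !pd_upd (pdC z j) (pdC z u) (pdC j u f) (pdC j u) (pdC j z).
- by have := rz u i (upd w u 0) ui; rewrite !pd_upd (pdC i z f).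
- by have := rz u j (upd w u 0) uj; rewrite !pd_upd (pdC j z f).
- move=> s; have := ru i j (upd w z s) ij.
  rewrite (multiaffine_pd u mf z) (multiaffine_pd i (multiaffine_pd u mf) z).
  rewrite (multiaffine_pd j (multiaffine_pd u mf) z).
  rewrite (multiaffine_pd i (multiaffine_pd j (multiaffine_pd u mf)) z).
  by rewrite !(pdC z i) !(pdC z j) (pdC z u) !(pdC i u) !(pdC j u) !(pdC i u) !(pdC j z) !(pdC i z).
- move=> s; have := rz i j (upd w u s) ij.
  rewrite (multiaffine_pd z mf u) (multiaffine_pd i (multiaffine_pd z mf) u).
  rewrite (multiaffine_pd j (multiaffine_pd z mf) u).
  rewrite (multiaffine_pd i (multiaffine_pd j (multiaffine_pd z mf)) u).
  by rewrite !(pdC j z) !(pdC i z).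
Qed.

End Merge.

(** * Barriers under a merge, and undoing a merge *)

Section Selection.
Variables (R : rcfType) (J : finType).
Implicit Types (f g h : (J -> R) -> R) (w x y : J -> R) (i j k u z : J).
Implicit Types (S T V : {set J}).

(** The barrier function of Marcus, Spielman and Srivastava: the logarithmic derivative along
    [j]. *)
Definition barrier j f x : R := pd j f x / f x.

(** On the diagonal through [x] in the coordinates [u] and [z], [f] is a quadratic with roots [- xi]
    and [- eta], where [xi <= eta]. The barriers of [u] and [z] add up to [xi^-1 + eta^-1], and the
    merged variable, lowered by [xi], has barrier [eta^-1]. *)
Lemma merge_step f x V u z : mstable f -> u \in V -> z \in V -> u != z ->
  above V f x ->
  exists xi, let g := merge u z f in let x' := upd x u (x u + x z - xi) in
  [/\ 0 < xi, mstable g, above (V :\ z) g x',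
      forall j, j \in V -> j != u -> j != z -> barrier j g x' <= barrier j f x
    & barrier u g x' = barrier u f x + barrier z f x - xi^-1].
Proof.
move=> sf uV zV uz Hf; have [mf rf] := sf.
have zu : z != u by rewrite eq_sym.
have uVz : u \in V :\ z by rewrite !inE uz.
have a0 : 0 < pd u (pd z f) x.
  exact: above_pd_gt0 uVz (above_pd zV Hf).
have fu0 := above_pd_gt0 uV Hf; have fz0 := above_pd_gt0 zV Hf.
have f0 := above_gt0 Hf.
(* The Rayleigh inequality for [(u, z)] makes the roots on the diagonal real. *)
have disc : 4 * pd u (pd z f) x * f x <= (pd u f x + pd z f x) ^+ 2.
  have := rf u z x uz; move: (pd u (pd z f) x) (pd u f x) (pd z f x) (f x) => a b c d.
  have := sqr_ge0 (b - c); nra.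
have [xi [eta [xi0 xe gE fE]]] := quadratic_roots a0 (addr_gt0 fu0 fz0) f0 disc.
have eta0 : 0 < eta by apply: lt_le_trans xe.
exists xi => g x'.
have sg : mstable g by apply: (mstable_merge (x := x)); rewrite // gt_eqF.
have gx' : g x' = pd u (pd z f) x * eta.
  rewrite /g /x' mergeE // gE; ring.
split=> //.
- apply: (above_extend (i := u)) => //; last by rewrite gx' mulr_gt0.
  rewrite pd_merge_l // /x'; apply/above_pd_upd.
  exact: above_pd uVz (above_pd zV Hf).
- move=> j jV ju jz; rewrite /barrier gx' /g pd_merge // /x' mergeE //; last exact: multiaffine_pd.
  set fj := pd j f.
  have mj : multiaffine fj by apply: multiaffine_pd.
  (* The barrier of [j] does not increase exactly when [fj] is nonnegative at the larger root [- xi]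
     of [f] on the diagonal. Adding the Rayleigh inequalities for [(j, u)] and [(j, z)] gives the
     sign of the Wronskian of [f] and [fj] along the diagonal. *)
  have psi0 : 0 <= fj x - xi * (pd u fj x + pd z fj x) + xi ^+ 2 * pd u (pd z fj) x.
    apply: (@wronskian_root_ge0 _ _ (pd u fj x + pd z fj x - 2 * xi * pd u (pd z fj) x)
       (pd u (pd z fj) x) (eta - xi)); first by rewrite subr_ge0.
    move=> e _; pose t := e - xi; pose w := upd (upd x u (x u + t)) z (x z + t).
    have wu F : multiaffine F -> pd u F w = pd u F x + t * pd u (pd z F) x.
      move=> mF; rewrite multiaffine_diag //; last exact: multiaffine_pd.
      rewrite (pdC z u F) !pd_pd; ring.
    have wz F : multiaffine F -> pd z F w = pd z F x + t * pd u (pd z F) x.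
      move=> mF; rewrite multiaffine_diag //; last exact: multiaffine_pd.
      rewrite !pd_pd pd_cst; ring.
    have := lerD (rf j u w ju) (rf j z w jz).
    rewrite !(pdC j) -/fj !wu // !wz // {1 2}/w !multiaffine_diag // gE fE.
    rewrite -subr_ge0 /t => h; rewrite -subr_ge0 -(pmulr_rge0 _ a0).
    have fzE : pd z f x = pd u (pd z f) x * (xi + eta) - pd u f x.
      by rewrite -gE addrC addKr.
    by apply: le_trans h _; rewrite fzE le_eqVlt; apply/orP; left; apply/eqP; ring.
  have -> : x u + x z - xi - x u - x z = - xi by ring.
  rewrite fE ler_pdivrMr ?mulr_gt0 //.
  have -> : fj x / (pd u (pd z f) x * xi * eta) * (pd u (pd z f) x * eta) = fj x / xi.
    by field; rewrite !gt_eqF.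
  rewrite ler_pdivlMr // -subr_ge0.
  rewrite (_ : _ - _ = fj x - xi * (pd u fj x + pd z fj x)
                       + xi ^+ 2 * pd u (pd z fj) x) //; ring.
rewrite /barrier gx' /g pd_merge_l // /x' pd_upd -mulrDl gE fE; field.
by rewrite !gt_eqF.
Qed.

Lemma pds_merge T u z f : z \notin T -> pds T (merge u z f) = merge u z (pds T f).
Proof.
elim/set_ind_U1: T => [|i T iT IH]; first by rewrite !pds0.
rewrite !inE negb_or => /andP[zi zT].
by rewrite !pdsU1 // IH // pd_merge // eq_sym.
Qed.

(* The merged polynomial is the sum of pd u f and pd z f, so at a point where it
   is positive one of the two is positive as well. *)
Lemma unmerge f V u z S y : mstable f -> u \in V -> z \in V -> u != z ->
  S \subset V :\ z ->
  above S (pds ((V :\ z) :\: S) (merge u z f)) (upd y u (y u + y z)) ->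
  exists S', [/\ S' \subset V, above S' (pds (V :\: S') f) y,
     forall j, j \in S -> j != u -> j \in S'
   & u \in S -> (u \in S') || (z \in S')].
Proof.
move=> sf uV zV uz SV H; have [mf _] := sf.
have zu : z != u by rewrite eq_sym.
have zS : z \notin S by apply/negP => /(subsetP SV); rewrite !inE eqxx.
have SV' : S \subset V by apply: subset_trans SV (subD1set _ _).
(* If the merged variable was derived away, then both [u] and [z] are, because
   [pd u (merge u z f) = pd u (pd z f)]. *)
have [uS|uS] := boolP (u \in S); last first.
  exists S; split=> //.
  have [W [uW zW e1 e2]] : exists W : {set J}, [/\ u \notin W, z \notin W,
      (V :\ z) :\: S = u |: W & V :\: S = z |: (u |: W)].
    exists ((V :\ z) :\: S :\ u); have e1 := setD1K (a := u) (A := (V :\ z) :\: S).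
    split; rewrite ?e1 ?inE ?eqxx ?uS ?uz ?andbF //.
    by apply/setP => j; rewrite !inE; case: (eqVneq j z) => [->|//]; rewrite zS zV.
  move: H; rewrite e1 e2.
  rewrite pdsU1 // pds_merge // pd_merge_l // => /above_pd_upd.
  have zuW : z \notin u |: W by rewrite !inE negb_or zu.
  by rewrite (pdsU1 _ zuW) (pdsU1 _ uW) pdC.
set T := (V :\ z) :\: S in H *.
have zT : z \notin T by rewrite !inE eqxx /= andbF.
have uT : u \notin T by rewrite !inE uS.
rewrite pds_merge // in H; set h := pds T f in H.
have sh : mstable h by apply: mstable_pds.
have [mh _] := sh.
have := above_gt0 H; rewrite mergeE // (_ : y u + y z - y u - y z = 0); last by ring.
rewrite mul0r addr0 => sum0.
have Hd : above (S :\ u) (pd u (pd z h)) y.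
  by have := above_pd uS H; rewrite pd_merge_l // => /above_pd_upd.
(* If [pd z h] is positive at [y], then [z] is derived away and [u] is kept; otherwise [pd u h] is
   positive and the roles are exchanged. *)
have [hz|hz] := ltP 0 (pd z h y).
  exists S; split=> //; last by rewrite uS.
  have -> : V :\: S = z |: T.
    by apply/setP => j; rewrite !inE; case: (eqVneq j z) => [->|//]; rewrite zS zV.
  by rewrite pdsU1 //; apply: (above_extend (i := u)) => //; apply: mstable_pd.
exists (z |: (S :\ u)); split.
- by rewrite subUset sub1set zV (subset_trans (subD1set _ _)).
- have -> : V :\: (z |: (S :\ u)) = u |: T.
    apply/setP => j; rewrite !inE; case: (eqVneq j u) => [->|ju] /=.
      by rewrite (negPf uz) uV.
    by rewrite negb_or; case: (j == z); rewrite ?andbF.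
  rewrite pdsU1 //; apply: (above_extend (i := z)) => //; first exact: mstable_pd.
    rewrite (pdC z); apply: aboveS Hd; apply/subsetP => j; rewrite !inE.
    by case: (j == z).
  by rewrite ltNge; apply/negP => hu; move: sum0; rewrite ltNge; apply/negP/negPn; lra.
- by move=> j jS ju; rewrite !inE ju jS orbT.
- by move=> _; rewrite setU11 orbT.
Qed.

End Selection.

(** * Merging groups of variables *)

Section GroupMerge.
Variables (R : rcfType) (J : finType).
Implicit Types (f g h : (J -> R) -> R) (w x y : J -> R) (i j k u z : J).
Implicit Types (S T V : {set J}).

(** A variable that has been merged away no longer occurs, so its coordinate may be changed
    freely. *)
Lemma eq_off_dead f (D : {set J}) x y : multiaffine f ->
  (forall j, j \in D -> pd j f = fun=> 0) -> (forall j, j \notin D -> x j = y j) ->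
  f x = f y.
Proof.
move=> mf; elim/set_ind_U1: D y => [|i D iD IH] y fD xy.
  by congr f; apply/funext => j; apply: xy; rewrite inE.
rewrite (IH (upd y i (x i))).
- by rewrite multiaffineE // fD ?inE ?eqxx // mulr0 addr0.
- by move=> j jD; apply: fD; rewrite !inE jD orbT.
move=> j jD; rewrite /upd; case: eqP => [->//|/eqP ji].
by apply: xy; rewrite !inE negb_or ji.
Qed.

Lemma above_off_dead f V (D : {set J}) x y : mstable f ->
  (forall j, j \in D -> pd j f = fun=> 0) -> (forall j, j \notin D -> x j = y j) ->
  above V f x -> above V f y.
Proof.
move=> sf fD xy H S SV; rewrite -(@eq_off_dead _ D x y) //; first exact: H.
  by have [] := mstable_pds S sf.
move=> j jD; rewrite -pds_pd fD //.
by elim/set_ind_U1: S {SV} => [|k S kS IH]; rewrite ?pds0 // pdsU1 // IH pd_cst.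
Qed.

(** The elements of [zs] are merged into [u] one by one. The barrier of [u] changes at each merge,
    hence its separate bound [beta]; the other barriers stay below [alpha]. The last clause turns a
    selection for the merged polynomial into one for [f], in which a kept [u] becomes some kept
    element of the group. *)
Lemma merge_group (zs : seq J) : forall f x V u (alpha beta : R),
  mstable f -> above V f x -> uniq (u :: zs) -> {subset u :: zs <= V} ->
  0 < alpha -> barrier u f x <= beta ->
  (forall z, z \in zs -> barrier z f x <= alpha) ->
  exists g x', let V' := V :\: [set z in zs] in
  [/\ mstable g /\ above V' g x',
      forall j, j \in V -> j \notin u :: zs -> barrier j g x' <= barrier j f x,
      (forall j, j != u -> x' j = x j) /\
      x' u <= x u + \sum_(z <- zs) x z
              - (size zs)%:R ^+ 2 / (beta + (size zs)%:R * alpha),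
      forall j, j \in zs \/ pd j f = (fun=> 0) -> pd j g = fun=> 0
    & forall S y, S \subset V' ->
        above S (pds (V' :\: S) g) (upd y u (y u + \sum_(z <- zs) y z)) ->
        exists S', [/\ S' \subset V, above S' (pds (V :\: S') f) y,
          forall j, j \in S -> j != u -> j \in S'
        & u \in S -> exists2 v, v \in u :: zs & v \in S']].
Proof.
elim: zs => [|z zs IH] f x V u alpha beta sf Hf uniq_zs sub a0 bu bz.
  exists f, x; rewrite (_ : V :\: [set z in [::]] = V); last first.
    by apply/setP => j; rewrite !inE.
  split=> //.
  - by rewrite big_nil expr0n mul0r addr0 subr0; split.
  - by move=> j [].
  move=> S y SV; rewrite big_nil addr0 upd_id => HS; exists S; split=> //.
  by move=> uS; exists u; rewrite ?inE.
have uV : u \in V by apply: sub; rewrite !inE eqxx.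
have zV : z \in V by apply: sub; rewrite !inE eqxx orbT.
move: uniq_zs => /=; rewrite inE negb_or => /and3P[/andP[uz uzs] zzs uniq_zs].
have [xi [xi0 sf1 Hf1 bf1 bu1]] := merge_step sf uV zV uz Hf.
set f1 := merge u z f in sf1 Hf1 bf1 bu1; set x1 := upd x u _ in Hf1 bf1 bu1.
have zsu z' : z' \in zs -> z' != u by apply: contraTneq => ->.
have zsz z' : z' \in zs -> z' != z by apply: contraTneq => ->.
have bzs z' : z' \in zs -> barrier z' f1 x1 <= alpha.
  move=> z'zs; apply: le_trans (bf1 _ _ (zsu _ z'zs) (zsz _ z'zs)) _.
    by apply: sub; rewrite !inE z'zs !orbT.
  by apply: bz; rewrite inE z'zs orbT.
have sub1 : {subset u :: zs <= V :\ z}.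
  move=> j; rewrite !inE => /predU1P[->|jzs]; first by rewrite uz.
  by rewrite (zsz _ jzs) sub // !inE jzs !orbT.
have uuzs : uniq (u :: zs) by rewrite /= uzs.
have [g [x' [[sg Hg] bg [x'E x'u] dead back]]] :=
  IH f1 x1 (V :\ z) u alpha _ sf1 Hf1 uuzs sub1 a0 (lexx _) bzs.
have VE : (V :\ z) :\: [set z0 in zs] = V :\: [set z0 in z :: zs].
  by apply/setP => j; rewrite !inE negb_or; case: (j == z); rewrite ?andbF.
rewrite VE in Hg back.
exists g, x'; split=> //.
- move=> j jV; rewrite !inE !negb_or => /and3P[ju jz jzs].
  by apply: le_trans (bf1 _ jV ju jz); apply: bg; rewrite !inE ?negb_or ?jz ?ju.
- split; first by move=> j ju; rewrite x'E // /x1 upd_neq.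
  apply: (le_trans x'u); rewrite big_cons.
  rewrite (eq_big_seq x) => [|z' z'zs]; last by rewrite /x1 upd_neq // zsu.
  rewrite {1}/x1 upd_at.
  have b1 : 0 < barrier u f1 x1.
    rewrite /barrier divr_gt0 ?(above_gt0 Hf1) //.
    by apply: (above_pd_gt0 _ Hf1); rewrite !inE uz.
  set k := (size zs)%:R : R; have k0 : 0 <= k by rewrite ler0n.
  rewrite (_ : (size (z :: zs))%:R = k + 1); last by rewrite /= -natr1.
  have d1 : 0 < barrier u f1 x1 + k * alpha by rewrite ltr_wpDr // mulr_ge0 // ltW.
  (* The present shift is [1 / xi^-1] and the later ones total at least
     [k ^+ 2 / (barrier u f1 x1 + k * alpha)]. In the sum of the denominators [xi^-1] cancels
     against the barrier of the merged variable. *)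
  have h1 := titu k0 (@ltr01 R) d1 (_ : 0 < xi^-1).
  rewrite invrK expr1n mul1r invr_gt0 in h1.
  have {}h1 := h1 xi0.
  have h2 : (k + 1) ^+ 2 / (beta + (k + 1) * alpha)
      <= (k + 1) ^+ 2 / (barrier u f1 x1 + k * alpha + xi^-1).
    have le1 : barrier u f1 x1 + k * alpha + xi^-1 <= beta + (k + 1) * alpha.
      by rewrite bu1; have := bz z (mem_head _ _); lra.
    have gt0 : 0 < barrier u f1 x1 + k * alpha + xi^-1 by rewrite addr_gt0 ?invr_gt0.
    rewrite ler_wpM2l ?sqr_ge0 // lef_pV2 ?posrE //.
    exact: lt_le_trans le1.
  lra.
- move=> j jd; apply: dead; case: jd => [|fj].
    rewrite inE => /predU1P[->|]; last by left.
    by right; rewrite /f1 pd_merge_r.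
  have [->|jz] := eqVneq j z; right; first by rewrite /f1 pd_merge_r.
  by rewrite /f1 pd_merge // fj /merge !pd_cst; apply/funext => w; rewrite addr0.
move=> S y SV HS.
have /back : S \subset V :\: [set z0 in z :: zs] by [].
(* Merges are undone in reverse order: first those of [zs], at the point where [z] is already added
   to [u], then that of [z]. *)
pose y1 := upd y u (y u + y z).
move=> /(_ y1); rewrite /y1 upd_upd upd_at.
rewrite (eq_big_seq y) => [|z' z'zs]; last by rewrite upd_neq // zsu.
rewrite big_cons addrA in HS => /(_ HS) [S1 [S1V HS1 S1j S1u]].
have [S2 [S2V HS2 S2j S2u]] := unmerge sf uV zV uz S1V HS1.
exists S2; split=> //; first by move=> j jS ju; apply: S2j => //; apply: S1j.
move=> /S1u [v vzs vS1]; have [vu|vu] := eqVneq v u.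
  have /S2u/orP[?|?] : u \in S1 by rewrite -vu.
    by exists u; rewrite // mem_head.
  by exists z; rewrite // !inE eqxx orbT.
exists v; last exact: S2j.
by move: vzs; rewrite !inE => /orP[->//|->]; rewrite !orbT.
Qed.

End GroupMerge.

(** * Keeping at least one copy in every group *)

Section SelectGroups.
Variables (R : rcfType) (I : finType) (r : nat).
Local Notation J := (I * 'I_r.+1)%type.
Implicit Types (f : (J -> R) -> R) (V : {set J}).

(** Merging the [r.+1] copies of [i] takes [r] merges, so the merged variable falls by at least
    [r ^ 2 / (alpha + r * alpha)]. Shared equally among the copies, this is
    [(r / (r + 1)) ^ 2 / alpha] for each. The remaining groups are treated on the merged polynomial
    before the merges of [i] are undone. *)
Lemma select_groups (gs : seq I) : forall f V x (alpha t : R),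
  uniq gs -> mstable f -> above V f x -> 0 < alpha ->
  (forall i l, i \in gs ->
     [/\ (i, l) \in V, x (i, l) = t & barrier (i, l) f x <= alpha]) ->
  exists S : {set J},
  [/\ S \subset V,
      above S (pds (V :\: S) f)
        (fun p => if p.1 \in gs then t - (r%:R / r.+1%:R) ^+ 2 / alpha else x p),
      forall p, p \in V -> p.1 \notin gs -> p \in S
    & forall i, i \in gs -> exists l, (i, l) \in S].
Proof.
elim: gs => [|i gs IH] f V x alpha t.
  by move=> _ sf Hf _ _; exists V; split=> //; rewrite setDv pds0.
move=> /= /andP[iis uis] sf Hf a0 Hi.
set c := t - _.
pose u : J := (i, ord0).
pose zs : seq J := [seq (i, lift ord0 l) | l <- enum 'I_r].
have size_zs : size zs = r by rewrite size_map size_enum_ord.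
have zsE p : p \in zs = (p.1 == i) && (p.2 != ord0).
  apply/mapP/andP => [[l _ ->] /=|]; first by rewrite eqxx.
  case: p => p1 p2 /= [/eqP -> ]; rewrite eq_sym => /unlift_some[l p2E _].
  by exists l; rewrite ?mem_enum // p2E.
have uzsE p : p \in u :: zs = (p.1 == i).
  rewrite inE zsE /u; case: p => p1 p2 /=; rewrite xpair_eqE.
  by case: (p1 == i) => //=; case: (p2 == ord0).
have uniq_zs : uniq (u :: zs).
  rewrite /= zsE /= eqxx /= map_inj_uniq ?enum_uniq // => a b [].
  by move/val_inj.
have inis p : p \in u :: zs ->
    exists2 l, p = (i, l) & [/\ p \in V, x p = t & barrier p f x <= alpha].
  rewrite uzsE; case: p => p1 p2 /eqP /= ->; exists p2 => //.
  by apply: Hi; rewrite mem_head.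
have sub : {subset u :: zs <= V} by move=> p /inis[_ _ []].
have bu : barrier u f x <= alpha by have [_ _ []] := inis u (mem_head _ _).
have bz z : z \in zs -> barrier z f x <= alpha.
  by move=> zzs; have [_ _ []] := inis z (mem_behead (s := u :: zs) zzs).
have [g [x' [[sg Hg] bg [x'E x'u] dead back]]] :=
  merge_group sf Hf uniq_zs sub a0 bu bz.
set V' := V :\: _ in Hg back.
have V'E p : p.1 != i -> (p \in V') = (p \in V).
  by move=> pi; rewrite !inE zsE (negPf pi).
have neq_u p : p.1 != i -> p != u by apply: contraNneq => ->.
have notin_uzs p : p.1 != i -> p \notin u :: zs by rewrite uzsE.
have Hi' i' l : i' \in gs ->
    [/\ (i', l) \in V', x' (i', l) = t & barrier (i', l) g x' <= alpha].
  move=> i'is; have i'i : i' != i by apply: contraNneq iis => <-.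
  have [pV xt bp] : [/\ (i', l) \in V, x (i', l) = t & barrier (i', l) f x <= alpha].
    by apply: Hi; rewrite inE i'is orbT.
  split; first by rewrite V'E.
    by rewrite x'E // neq_u.
  by apply: le_trans bp; apply: bg => //; apply: notin_uzs.
have [S [SV HS Snot Sin]] := IH g V' x' alpha t uis sg Hg a0 Hi'.
pose y p := if p.1 \in i :: gs then c else x p.
(* The group of [i] lies outside [gs], so the selection keeps its merged variable. *)
have uS : u \in S.
  by apply: Snot => //; rewrite !inE zsE /= eqxx sub // mem_head.
have yzs z : z \in u :: zs -> y z = c.
  by rewrite uzsE => /eqP zi; rewrite /y zi mem_head.
have sum_y : y u + \sum_(z <- zs) y z = r.+1%:R * c.
  rewrite (eq_big_seq (fun=> c)); last by move=> z zzs; apply: yzs; rewrite inE zzs orbT.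
  rewrite big_const_seq count_predT size_zs iter_addr_0 yzs ?mem_head //.
  by rewrite -mulr_natl -natr1; ring.
have sum_x : x u + \sum_(z <- zs) x z = r.+1%:R * t.
  have xt z : z \in u :: zs -> x z = t by move=> /inis[_ _ []].
  rewrite (eq_big_seq (fun=> t)); last by move=> z zzs; apply: xt; rewrite inE zzs orbT.
  rewrite big_const_seq count_predT size_zs iter_addr_0 xt ?mem_head //.
  by rewrite -mulr_natl -natr1; ring.
have x'c : x' u <= r.+1%:R * c.
  apply: (le_trans x'u); rewrite sum_x size_zs le_eqVlt; apply/orP; left; apply/eqP.
  rewrite /c -natr1; field.
  by rewrite natr1 pnatr_eq0 !gt_eqF //= ltr_wpDr // mulr_ge0 ?ler0n // ltW.
have sgS : mstable (pds (V' :\: S) g) by apply: mstable_pds.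
(* The merged variable lies at or below [r.+1%:R * c]; it is raised to that value, the sum of the
   coordinates of [y] over the group. *)
have HS' := above_raise sgS uS _ HS.
rewrite /= (negPf iis) in HS'; have {}HS' := HS' _ x'c.
have /back : S \subset V' by [].
move=> /(_ y); rewrite sum_y.
case.
  apply: (above_off_dead (D := [set z in zs]) sgS _ _ HS').
    move=> z; rewrite inE => zzs; rewrite -pds_pd dead; last by left.
    elim/set_ind_U1: (V' :\: S) => [|k T kT IHT]; first by rewrite pds0.
    by rewrite pdsU1 // IHT pd_cst.
  move=> p; rewrite inE zsE negb_and negbK => pz; rewrite /upd; case: eqP => // /eqP pu.
  have p1i : p.1 != i.
    by apply: contraNneq pu => pi; move: pz; rewrite pi eqxx /= => /eqP p2;
      apply/eqP; rewrite /u -pi -p2; case: (p).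
  by rewrite /y inE (negPf p1i) x'E.
move=> S' [S'V HS'' S'j S'u]; exists S'; split=> //.
- move=> p pV; rewrite inE negb_or => /andP[pi pis].
  by apply: S'j; rewrite ?neq_u // Snot // V'E.
move=> i'; rewrite inE => /predU1P[->|i'is].
  by have [v] := S'u uS; rewrite uzsE; case: v => v1 v2 /eqP /= -> ?; exists v2.
have [l lS] := Sin _ i'is; exists l; apply: S'j => //; apply: neq_u.
by apply: contraNneq iis => <-.
Qed.

End SelectGroups.

(** * Principal minors of Hermitian matrices *)

Lemma cramer_delta (K : comNzRingType) n (M : 'M[K]_n) (v : 'cV[K]_n) i j :
  M *m v = delta_mx j 0 -> \det M * v i 0 = cofactor M j i.
Proof.
move=> Mv; have := congr1 (fun A : 'cV_n => A i 0) (mulmxA (\adj M) M v).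
rewrite /= Mv mul_adj_mx mul_scalar_mx !mxE => <-.
rewrite (bigD1 j) //= big1 => [|k kj]; first by rewrite !mxE !eqxx mulr1 addr0.
by rewrite !mxE (negPf kj) mulr0.
Qed.

Section HermitianPencil.
Variables (R : rcfType) (n : nat) (H : 'M[R[i]]_n).
Local Notation C := R[i].
Local Notation RtoC := (real_complex R).
Implicit Types (S T : {set 'I_n}) (w : 'I_n -> R) (u v : 'cV[C]_n).

(* diag(w) + H with the rows and columns in S replaced by those of the identity
   matrix: its determinant is the derivative of det (diag(w) + H) along S. *)
Definition pencil S w : 'M[C]_n :=
  \matrix_(a, b) if (a \in S) || (b \in S) then (a == b)%:R
                 else RtoC (w a) *+ (a == b) + H a b.

(** The real part only serves to land in the ordered field: for Hermitian [H] the determinant is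
    real, by [det_pencil_real]. *)
Definition pencil_det S w : R := complex.Re (\det (pencil S w)).

Lemma det_pencilU1 S i w : i \notin S ->
  \det (pencil (i |: S) w) = cofactor (pencil S w) i i.
Proof.
move=> iS; rewrite (expand_det_row _ i) (bigD1 i) //= big1 => [|j ji].
  rewrite !mxE !inE !eqxx /= mul1r addr0 /cofactor; congr (_ * \det _).
  by apply/matrixP => a b; rewrite !mxE !inE !(eq_sym _ i) !(negPf (neq_lift _ _)).
by rewrite !mxE !inE eqxx /= eq_sym (negPf ji) mul0r.
Qed.

Lemma det_pencil_upd S i w t : i \notin S ->
  \det (pencil S (upd w i t))
    = \det (pencil S (upd w i 0)) + RtoC t * \det (pencil (i |: S) w).
Proof.
move=> iS.
(* In [E] only row [i] is that of the identity; expansion along it shows that column [i] does not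
   affect the determinant. *)
pose E := \matrix_(a, b) if a == i then (a == b)%:R : C else pencil S w a b.
have -> : \det (pencil (i |: S) w) = \det E.
  rewrite det_pencilU1 // (expand_det_row _ i) (bigD1 i) //= big1 => [|j ji].
    rewrite !mxE !eqxx mul1r addr0 /cofactor; congr (_ * \det _).
    by apply/matrixP => a b; rewrite !mxE !(eq_sym _ i) !(negPf (neq_lift _ _)).
  by rewrite !mxE eqxx eq_sym (negPf ji) mul0r.
rewrite -[X in _ = X + _]mul1r; apply: (@determinant_multilinear _ _ _ _ _ i).
- apply/matrixP => a b; rewrite !mxE (negPf iS) /= eqxx !upd_at mul1r.
  case: (b \in S) (memPn iS b) => [bS|_].
    by rewrite eq_sym (negPf (bS isT)) mulr0 addr0.
  by rewrite rmorph0 mul0rn add0r addrC mulr_natr.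
- by apply/matrixP => a b; rewrite !mxE !upd_neq // eq_sym neq_lift.
- apply/matrixP => a b; rewrite !mxE !(eq_sym _ i) !(negPf (neq_lift _ _)).
  by rewrite upd_neq // eq_sym neq_lift.
Qed.

Lemma pencil_upd_in S i w t : i \in S -> pencil S (upd w i t) = pencil S w.
Proof.
move=> iS; apply/matrixP => a b; rewrite !mxE.
have [->|ai] := eqVneq a i; first by rewrite iS.
by rewrite upd_neq.
Qed.

Lemma ReD (x y : C) : complex.Re (x + y) = complex.Re x + complex.Re y.
Proof. by case: x; case: y. Qed.

Lemma ReMr (t : R) (x : C) : complex.Re (RtoC t * x) = t * complex.Re x.
Proof. by case: x => a b /=; rewrite mul0r subr0. Qed.

Lemma pd_pencil_det S i : pd i (pencil_det S)
  = if i \in S then fun=> 0 else pencil_det (i |: S).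
Proof.
apply/funext => w; rewrite /pd /pencil_det; case: ifPn => iS.
  by rewrite !pencil_upd_in // subrr.
by rewrite (det_pencil_upd _ 1) // ReD ReMr mul1r addrC addKr.
Qed.

Lemma multiaffine_pencil_det S : multiaffine (pencil_det S).
Proof.
move=> i w t; rewrite pd_pencil_det /pencil_det; case: ifPn => iS.
  by rewrite !pencil_upd_in // mulr0 addr0.
by rewrite det_pencil_upd // ReD ReMr.
Qed.

Lemma pencil_detT w : pencil_det [set: 'I_n] w = 1.
Proof.
rewrite /pencil_det (_ : pencil _ _ = 1%:M) ?det1 //.
by apply/matrixP => a b; rewrite !mxE inE.
Qed.

Definition ctr m p (A : 'M[C]_(m, p)) : 'M[C]_(p, m) := map_mx (@conjc R) A^T.

Lemma ctrE m p (A : 'M[C]_(m, p)) a b : ctr A a b = conjc (A b a).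
Proof. by rewrite !mxE. Qed.

Lemma ctrM m p q (A : 'M[C]_(m, p)) (B : 'M[C]_(p, q)) :
  ctr (A *m B) = ctr B *m ctr A.
Proof. by rewrite /ctr trmx_mul map_mxM. Qed.

Lemma ctrK m p (A : 'M[C]_(m, p)) : ctr (ctr A) = A.
Proof. by apply/matrixP => a b; rewrite !mxE conjcK. Qed.

Lemma mul_ctr_delta v j : (ctr v *m delta_mx j (0 : 'I_1)) 0 0 = conjc (v j 0).
Proof.
rewrite mxE (bigD1 j) //= big1 => [|k kj]; first by rewrite !mxE !eqxx mulr1 addr0.
by rewrite !mxE (negPf kj) mulr0.
Qed.

Hypothesis herm : ctr H = H.

Lemma ctr_pencil S w : ctr (pencil S w) = pencil S w.
Proof.
apply/matrixP => a b; have := congr1 (fun A : 'M_n => A a b) herm; rewrite !mxE.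
rewrite orbC (eq_sym b a); case: ifP => _ e; first by rewrite rmorph_nat.
rewrite rmorphD rmorphMn /= e; case: eqP => [->|//].
by rewrite oppr0.
Qed.

Lemma det_pencil_real S w : \det (pencil S w) = RtoC (pencil_det S w).
Proof.
rewrite /pencil_det; have : conjc (\det (pencil S w)) = \det (pencil S w).
  by rewrite -det_map_mx -[in RHS](ctr_pencil S w) /ctr -map_trmx det_tr.
case: (\det _) => a b /= [] /eqP; rewrite eq_sym -subr_eq0 opprK => bb.
congr (_ +i* _)%C; apply/eqP; move: bb; rewrite -mulr2n mulrn_eq0 /=.
by [].
Qed.

End HermitianPencil.

(** * Rayleigh inequalities and positivity for Hermitian pencils *)

Section HermitianForm.
Variables (R : rcfType) (n : nat) (H : 'M[R[i]]_n).
Local Notation C := R[i].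
Local Notation RtoC := (real_complex R).
Local Notation K := (pencil H).
Local Notation D := (pencil_det H).
Implicit Types (S T : {set 'I_n}) (w : 'I_n -> R) (u v x y : 'cV[C]_n).
Hypothesis herm : ctr H = H.

Lemma pencil_solve S w i : D S w != 0 -> exists x, K S w *m x = delta_mx i 0.
Proof.
move=> d0; exists (invmx (K S w) *m delta_mx i 0); rewrite mulmxA mulmxV ?mul1mx //.
rewrite unitmxE unitfE (det_pencil_real herm) -(rmorph0 RtoC).
by rewrite (inj_eq (@complexI R)).
Qed.

Lemma pencil_solve_diag S w i x : i \notin S -> K S w *m x = delta_mx i 0 ->
  RtoC (D S w) * x i 0 = RtoC (D (i |: S) w).
Proof.
move=> iS Kx; rewrite -!(det_pencil_real herm) det_pencilU1 //.
exact: cramer_delta.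
Qed.

(** The Rayleigh difference at [w] is [D set0 w ^+ 2] times the squared modulus of the entry
    [(j, i)] of the inverse matrix. This is Jacobi's identity for a two by two minor of the inverse,
    obtained here from Cramer's rule before and after a change of [w i]. *)
Lemma mstable_pencil_det w0 : D set0 w0 != 0 -> mstable (D set0).
Proof.
move=> d0; have mD := @multiaffine_pencil_det R n H.
apply: (mstable_of_generic (h := D set0) (x0 := w0)) => // i j w ij fw.
rewrite !pd_pencil_det !in_set0 pd_pencil_det !inE (negPf ij) /=.
have [vi Mvi] := pencil_solve i fw; have [vj Mvj] := pencil_solve j fw.
have n0 (a : 'I_n) : a \notin set0 by rewrite inE.
have Di := pencil_solve_diag (n0 i) Mvi.
have Dj := pencil_solve_diag (n0 j) Mvj.
have rr' : vj i 0 = conjc (vi j 0).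
  rewrite -(mul_ctr_delta vi) -Mvj mulmxA -{1}(ctr_pencil herm) -ctrM Mvi.
  rewrite mxE (bigD1 i) //= big1 => [|k ki]; first by rewrite !mxE !eqxx rmorph1 mul1r addr0.
  by rewrite !mxE (negPf ki) rmorph_nat mul0r.
set p := vi i 0 in Di; set q := vj j 0 in Dj; set r := vi j 0 in rr'.
(* One of the values 1 and 2 keeps the denominator of the rank-one update nonzero. *)
have [s [s0 sp]] : exists s : R, s != 0 /\ 1 + RtoC s * p != 0.
  have [p1|p1] := eqVneq (1 + p) 0.
    exists 2; split; first by rewrite pnatr_eq0.
    have -> : p = -1 by apply/eqP; rewrite -addr_eq0 addrC p1.
    by rewrite rmorph_nat mulrN1 -[X in X - _]/(1%:R) -opprB oppr_eq0 -natrB // pnatr_eq0.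
  by exists 1; split; rewrite ?oner_eq0 // rmorph1 mul1r.
pose w' := upd w i (w i + s).
have M'E v : K set0 w' *m v = K set0 w *m v + (RtoC s * v i 0) *: delta_mx i 0.
  apply/matrixP => a b; rewrite !mxE ord1 eqxx andbT.
  rewrite (bigD1 a) //= [in RHS](bigD1 a) //= !mxE !inE !eqxx /=.
  rewrite (eq_bigr (fun k => K set0 w a k * v k 0)) => [|k ka]; last first.
    by rewrite !mxE !inE /= eq_sym (negPf ka) !mulr0n.
  rewrite !mulr1n addrAC; congr (_ + _).
  rewrite /w' /upd; case: eqP => [->|_]; last by rewrite mulr0 addr0.
  by rewrite rmorphD /=; ring.
(* Sherman-Morrison: this multiple of [vi] corrects [vj] into the solution for [w']. *)
pose beta := RtoC s * vj i 0 / (1 + RtoC s * p).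
have Mv' : K set0 w' *m (vj - beta *: vi) = delta_mx j 0.
  have b0 : - beta + RtoC s * (vj - beta *: vi) i 0 = 0.
    by rewrite !mxE -/p /beta; field.
  by rewrite M'E mulmxBr -scalemxAr Mvi Mvj -addrA -scaleNr -scalerDl b0 scale0r addr0.
have := pencil_solve_diag (n0 j) Mv'.
rewrite !(multiaffineE _ _ _ (mD _)) !pd_pencil_det !inE (negPf ij) /=.
rewrite (_ : w i + s - w i = s); last by ring.
rewrite !setU0 in Di Dj *.
rewrite !rmorphD !rmorphM /= -Di -Dj !mxE -/q -/r /beta rr' => e.
have {}e : RtoC (D [set i; j] w) = RtoC (D set0 w) * (p * q - conjc r * r).
  have s0' : RtoC s != 0 by rewrite -(rmorph0 RtoC) (inj_eq (@complexI R)).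
  apply: (mulfI s0'); apply: (addrI (RtoC (D set0 w) * q)).
  by rewrite -e; field.
rewrite -subr_ge0 -ler0c rmorphB !rmorphM /= e -Di -Dj.
have -> : RtoC (D set0 w) * p * (RtoC (D set0 w) * q)
   - RtoC (D set0 w) * (RtoC (D set0 w) * (p * q - conjc r * r))
   = RtoC (D set0 w ^+ 2) * (r * conjc r) by rewrite rmorphXn /=; ring.
by rewrite mulr_ge0 ?mulcJ_ge0 // ler0c sqr_ge0.
Qed.

Lemma pencil_mul_in S w v a : a \in S -> (K S w *m v) a 0 = v a 0.
Proof.
move=> aS; rewrite mxE (bigD1 a) //= big1 => [|b ba].
  by rewrite !mxE aS eqxx mul1r addr0.
by rewrite !mxE aS /= eq_sym (negPf ba) mul0r.
Qed.

Lemma pencil_mul_notin S w v a : a \notin S -> (forall b, b \in S -> v b 0 = 0) ->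
  (K S w *m v) a 0 = (K set0 w *m v) a 0.
Proof.
move=> aS vS; rewrite !mxE; apply: eq_bigr => b _; rewrite !mxE !inE (negPf aS) /=.
by case: ifP => // /vS ->; rewrite !mulr0.
Qed.

(** For vectors vanishing on [S], the forms of [K S w] and [K set0 w] agree. *)
Lemma pencil_form_solve S w i x y : i \notin S ->
  K S w *m x = delta_mx i 0 -> (forall b, b \in S -> y b 0 = 0) ->
  (forall b, b \in S -> x b 0 = 0) /\
  (ctr y *m K set0 w *m x) 0 0 = conjc (y i 0).
Proof.
move=> iS Kx yS; have xS b : b \in S -> x b 0 = 0.
  move=> bS; rewrite -(pencil_mul_in w x bS) Kx !mxE.
  by rewrite (_ : b == i = false) //; apply/negP => /eqP bi; rewrite -bi bS in iS.
split=> //; rewrite -mulmxA -mul_ctr_delta -Kx !mxE; apply: eq_bigr => a _.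
have [aS|aS] := boolP (a \in S); last by rewrite pencil_mul_notin.
by rewrite !mxE yS // rmorph0 !mul0r.
Qed.

(* Sylvester's criterion; the inductive step splits off the K S w-orthogonal
   direction x with K S w *m x = e_i. *)
Lemma pencil_form_ge0 S w v : (forall T, S \subset T -> 0 < D T w) ->
  (forall b, b \in S -> v b 0 = 0) -> 0 <= (ctr v *m K set0 w *m v) 0 0.
Proof.
elim: {S}_.+1 {-2}S (ltnSn #|~: S|) v => // k IH S Sk v DS vS.
have [SC0|[i iSC]] := set_0Vmem (~: S).
  have -> : v = 0.
    apply/matrixP => a b; rewrite ord1 mxE vS //.
    by have := in_set0 a; rewrite -SC0 inE => /negbFE.
  by rewrite mulmx0 mxE.
have iS : i \notin S by move: iSC; rewrite inE.
have DS0 := DS _ (subxx S).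
have [x Kx] := pencil_solve i (lt0r_neq0 DS0).
have xi := pencil_solve_diag iS Kx.
pose xi_ := D (i |: S) w / D S w.
have xi0 : 0 < xi_ by rewrite divr_gt0 // DS // subsetUr.
have D0 : RtoC (D S w) != 0 by rewrite -(rmorph0 RtoC) (inj_eq (@complexI R)) gt_eqF.
have xiE : x i 0 = RtoC xi_.
  by apply: (mulfI D0); rewrite xi -rmorphM /xi_ mulrC divfK // gt_eqF.
have [xS _] := pencil_form_solve iS Kx vS.
have xiN : x i 0 != 0 by rewrite xiE -(rmorph0 RtoC) (inj_eq (@complexI R)) gt_eqF.
(* Subtracting [lam *: x] kills the coordinate [i], so [y] falls under the induction hypothesis for
   [i |: S] and is orthogonal to [x] for the form. *)
pose lam := v i 0 / x i 0; pose y := v - lam *: x.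
have yi : y i 0 = 0 by rewrite !mxE /lam divfK // subrr.
have yS b : b \in S -> y b 0 = 0 by move=> bS; rewrite !mxE vS // xS // mulr0 subr0.
have yiS b : b \in i |: S -> y b 0 = 0 by rewrite !inE => /predU1P[->//|/yS].
have IHy : 0 <= (ctr y *m K set0 w *m y) 0 0.
  apply: (IH (i |: S)) => // [|T sT]; last first.
    by apply: DS; apply: subset_trans sT; apply: subsetUr.
  rewrite -ltnS (leq_trans _ Sk) // ltnS; apply: proper_card.
  rewrite properEneq setCS subsetUr andbT; apply/eqP => /setC_inj e.
  by rewrite -e !inE eqxx in iS.
have [_ yx] := pencil_form_solve iS Kx yS.
have [_ xx] := pencil_form_solve iS Kx xS.
have xy : (ctr x *m K set0 w *m y) 0 0 = 0.
  have -> : ctr x *m K set0 w *m y = ctr (ctr y *m K set0 w *m x).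
    by rewrite !ctrM ctrK (ctr_pencil herm) mulmxA.
  by rewrite ctrE yx yi !rmorph0.
have vE : v = y + lam *: x by rewrite /y subrK.
clearbody y.
have cE : ctr v = ctr y + conjc lam *: ctr x.
  by rewrite vE; apply/matrixP => a b; rewrite !(ctrE, mxE) rmorphD rmorphM.
have -> : ctr v *m K set0 w *m v = ctr y *m K set0 w *m y
    + lam *: (ctr y *m K set0 w *m x) + conjc lam *: (ctr x *m K set0 w *m y)
    + (conjc lam * lam) *: (ctr x *m K set0 w *m x).
  rewrite cE {1}vE !mulmxDl !mulmxDr -!scalemxAl -!scalemxAr scalerA.
  by rewrite !addrA.
have e00 (A B : 'M[C]_1) : (A + B) 0 0 = A 0 0 + B 0 0 by rewrite mxE.
have z00 c (A : 'M[C]_1) : (c *: A) 0 0 = c * A 0 0 by rewrite mxE.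
rewrite !e00 !z00 yx xy xx yi xiE rmorph0 !mulr0 !addr0.
rewrite addr_ge0 // mulr_ge0 //; first by rewrite mulrC mulcJ_ge0.
by rewrite conjc_real ler0c ltW.
Qed.

End HermitianForm.

(** * Gram matrices: positivity and the initial barrier *)

Section Gram.
Variable R : rcfType.
Local Notation C := R[i].
Local Notation RtoC := (real_complex R).

Definition sqnorm m (v : 'cV[C]_m) : R := \sum_k Normc.normc (v k 0) ^+ 2.

Lemma sqnorm_ge0 m (v : 'cV[C]_m) : 0 <= sqnorm v.
Proof. by apply: sumr_ge0 => k _; apply: sqr_ge0. Qed.

Lemma sqr_normcE (z : C) : Normc.normc z ^+ 2 = complex.Re z ^+ 2 + complex.Im z ^+ 2.
Proof. by case: z => a b /=; rewrite sqr_sqrtr // addr_ge0 ?sqr_ge0. Qed.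

Lemma mulJc (z : C) : conjc z * z = RtoC (Normc.normc z ^+ 2).
Proof.
rewrite sqr_normcE; case: z => a b; apply/eqP; rewrite eq_complex /=.
by apply/andP; split; apply/eqP; ring.
Qed.

Lemma sqnorm_ctr m (v : 'cV[C]_m) : (ctr v *m v) 0 0 = RtoC (sqnorm v).
Proof.
by rewrite mxE rmorph_sum; apply: eq_bigr => k _; rewrite ctrE mulJc.
Qed.

Lemma sqnorm_eq0 m (v : 'cV[C]_m) : sqnorm v = 0 -> v = 0.
Proof.
move=> v0; apply/matrixP => a b; rewrite ord1 mxE.
have : Normc.normc (v a 0) ^+ 2 == 0.
  by move/eqP: v0; rewrite psumr_eq0 => [/allP/(_ a)|k _];
    rewrite ?mem_index_enum ?sqr_ge0 //; apply.
by rewrite sqrf_eq0 => /eqP /Normc.eq0_normc.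
Qed.

Lemma sqnormZ m (c : C) (v : 'cV[C]_m) :
  sqnorm (c *: v) = Normc.normc c ^+ 2 * sqnorm v.
Proof.
rewrite /sqnorm mulr_sumr; apply: eq_bigr => k _.
by rewrite mxE Normc.normcM exprMn.
Qed.

Lemma sqnormB_le m (u v : 'cV[C]_m) (s : R) : 0 < s ->
  sqnorm (u - v) <= (1 + s) * sqnorm u + (1 + s^-1) * sqnorm v.
Proof.
move=> s0; rewrite /sqnorm !mulr_sumr -big_split /=; apply: ler_sum => k _.
rewrite !mxE !sqr_normcE; case: (u k 0) => a b; case: (v k 0) => c d /=.
have e (x y : R) : (x - y) ^+ 2 <= (1 + s) * x ^+ 2 + (1 + s^-1) * y ^+ 2.
  rewrite -subr_ge0 (_ : _ - _ = (s * x + y) ^+ 2 / s); last by field; rewrite gt_eqF.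
  by rewrite divr_ge0 ?sqr_ge0 // ltW.
have := lerD (e a c) (e b d); lra.
Qed.

Variables (m n : nat) (A : 'M[C]_(m, n)).
Local Notation H := (ctr A *m A).
Local Notation D := (pencil_det H).
Local Notation K := (pencil H).

Lemma ctr_gram : ctr H = H.
Proof. by rewrite ctrM ctrK. Qed.

Lemma gram_form w (v : 'cV[C]_n) : (ctr v *m K set0 w *m v) 0 0
  = RtoC (\sum_a w a * Normc.normc (v a 0) ^+ 2 + sqnorm (A *m v)).
Proof.
have -> : K set0 w = diag_mx (\row_a RtoC (w a)) + H.
  by apply/matrixP => a b; rewrite !mxE !inE.
rewrite mulmxDr mulmxDl rmorphD /= -sqnorm_ctr ctrM !mulmxA mxE; congr (_ + _).
rewrite mxE rmorph_sum; apply: eq_bigr => a _.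
rewrite mul_mx_diag mxE ctrE mxE mulrAC mulJc -rmorphM /=; congr RtoC; exact: mulrC.
Qed.

(** A kernel vector vanishes on [S], hence annihilates the form of [K set0 w], which is positive
    definite when all [w a] are positive. *)
Lemma det_gram_pencil_neq0 S w : (forall a, 0 < w a) -> D S w != 0.
Proof.
move=> w0; apply/eqP => d0.
have : \det (K S w) == 0 by rewrite (det_pencil_real ctr_gram) d0 rmorph0.
move/det0P => [v v0 vK].
have Ku : K S w *m ctr v = 0.
  by rewrite -(ctr_pencil ctr_gram) -ctrM vK; apply/matrixP => a b; rewrite ctrE !mxE rmorph0.
set u := ctr v in Ku.
have uS b : b \in S -> u b 0 = 0 by move=> bS; rewrite -(pencil_mul_in H w u bS) Ku mxE.
have : (ctr u *m K set0 w *m u) 0 0 = 0.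
  rewrite -mulmxA mxE big1 // => a _; have [aS|aS] := boolP (a \in S).
    by rewrite ctrE uS // rmorph0 mul0r.
  by rewrite -(pencil_mul_notin _ _ aS uS) Ku [X in _ * X]mxE mulr0.
rewrite gram_form => /(@complexI R _ 0) e.
have s1 : 0 <= \sum_a w a * Normc.normc (u a 0) ^+ 2.
  by apply: sumr_ge0 => a _; rewrite mulr_ge0 ?sqr_ge0 // ltW.
have /eqP : \sum_a w a * Normc.normc (u a 0) ^+ 2 = 0.
  by have := sqnorm_ge0 (A *m u); lra.
rewrite psumr_eq0 => [/allP h|a _]; last by rewrite mulr_ge0 ?sqr_ge0 // ltW.
case/eqP: v0; rewrite -[v]ctrK; apply/matrixP => a b; rewrite ord1 ctrE [RHS]mxE.
have := h b (mem_index_enum b); rewrite mulf_eq0 gt_eqF //= sqrf_eq0.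
by move/eqP/Normc.eq0_normc ->; rewrite rmorph0.
Qed.

(** By induction on the complement of [S], the determinant is affine in [w i] with positive slope.
    Were it negative, raising [w i] would produce a zero at a positive point. *)
Lemma det_gram_pencil_gt0 S w : (forall a, 0 < w a) -> 0 < D S w.
Proof.
elim: {S}_.+1 {-2}S (ltnSn #|~: S|) w => // k IH S Sk w w0.
have [SC0|[i iSC]] := set_0Vmem (~: S).
  by rewrite -[S]setCK SC0 setC0 pencil_detT ltr01.
have iS : i \notin S by move: iSC; rewrite inE.
have DU : 0 < D (i |: S) w.
  apply: IH => //; rewrite -ltnS (leq_trans _ Sk) // ltnS; apply: proper_card.
  rewrite properEneq setCS subsetUr andbT; apply/eqP => /setC_inj e.
  by rewrite -e !inE eqxx in iS.
rewrite lt_neqAle eq_sym det_gram_pencil_neq0 //= leNgt; apply/negP => neg.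
pose s := w i - D S w / D (i |: S) w.
have ws : w i < s by rewrite /s ltrDl oppr_gt0 pmulr_llt0 ?invr_gt0.
have w'0 a : 0 < upd w i s a.
  by rewrite /upd; case: eqP => // _; apply: lt_trans ws.
have /eqP := det_gram_pencil_neq0 S w'0; apply.
rewrite (multiaffineE _ _ _ (@multiaffine_pencil_det _ _ _ S)) pd_pencil_det (negPf iS).
rewrite /s addrAC subrr add0r mulNr divfK ?subrr // ?gt_eqF //.
Qed.

(** The barrier [xi_] is the diagonal entry of the inverse, and its column [x] satisfies
    [t * sqnorm x + sqnorm (A *m x) = xi_]. Comparing [x] with [xi_] times the basis vector brings
    in the unit norm of the column of [A], which improves the trivial bound [t^-1]. *)
Lemma gram_barrier (b t : R) i : 0 < b -> 0 < t ->
  (forall v : 'cV[C]_n, sqnorm (A *m v) <= b * sqnorm v) ->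
  sqnorm (A *m delta_mx i 0) = 1 ->
  D [set i] (fun=> t) / D set0 (fun=> t) <= (t + t / (t + b))^-1.
Proof.
move=> b0 t0 Ab Ai.
have D0 S : 0 < D S (fun=> t) by apply: det_gram_pencil_gt0.
have [x Kx] := pencil_solve ctr_gram i (lt0r_neq0 (D0 set0)).
have n0 : i \notin set0 by rewrite inE.
have := pencil_solve_diag ctr_gram n0 Kx; rewrite setU0 => xi.
set xi_ := _ / _.
have xi0 : 0 < xi_ by rewrite divr_gt0.
have xiE : x i 0 = RtoC xi_.
  have d0 : RtoC (D set0 (fun=> t)) != 0.
    by rewrite -(rmorph0 RtoC) (inj_eq (@complexI R)) gt_eqF.
  by apply: (mulfI d0); rewrite xi -rmorphM /xi_ mulrC divfK // gt_eqF.
have xS b' : b' \in (set0 : {set 'I_n}) -> x b' 0 = 0 by rewrite inE.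
have [_] := pencil_form_solve n0 Kx xS.
rewrite gram_form xiE conjc_real => /complexI; rewrite -mulr_sumr -/(sqnorm x) => energy.
pose y := x - RtoC xi_ *: delta_mx i 0.
have yE : sqnorm y = sqnorm x - xi_ ^+ 2.
  rewrite /sqnorm (bigD1 i) //= [in RHS](bigD1 i) //= !mxE !eqxx mulr1 xiE subrr.
  rewrite Normc.normc0 expr0n add0r sqr_normcE /= expr0n /= addr0 addrAC subrr add0r.
  by apply: eq_bigr => k ki; rewrite !mxE (negPf ki) mulr0 subr0.
have AiE : RtoC xi_ *: (A *m delta_mx i 0) = A *m x - A *m y.
  by rewrite -mulmxBr /y opprB addrC subrK -scalemxAr.
(* With the weight [b / t] the error term [sqnorm (A *m y)] costs [(1 + b / t) * t] per unit of
   [sqnorm y], the same rate at which the energy identity pays for [sqnorm x]. *)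
have s0 : 0 < b / t by rewrite divr_gt0.
have := sqnormB_le (A *m x) (A *m y) s0; rewrite -AiE sqnormZ Ai mulr1 sqr_normcE /=.
rewrite expr0n /= addr0 => h1.
have h2 := Ab y; rewrite yE in h2.
have e1 : (1 + (b / t)^-1) * b = (1 + b / t) * t by field; rewrite !gt_eqF.
have p0 : 0 < 1 + (b / t)^-1 by rewrite addr_gt0 ?invr_gt0.
have h3 : (1 + (b / t)^-1) * sqnorm (A *m y) <= (1 + b / t) * t * (sqnorm x - xi_ ^+ 2).
  by rewrite -e1 -mulrA ler_pM2l.
have h4 : xi_ ^+ 2 <= (1 + b / t) * (xi_ - t * xi_ ^+ 2).
  by rewrite -[X in _ * (X - _)]energy; lra.
have h5 : xi_ <= (1 + b / t) * (1 - t * xi_).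
  by rewrite -(ler_pM2l xi0) -expr2; apply: le_trans h4 _;
     rewrite le_eqVlt; apply/orP; left; apply/eqP; ring.
have tb : 0 < t + b by rewrite addr_gt0.
rewrite -div1r ler_pdivlMr ?addr_gt0 ?divr_gt0 //.
have -> : xi_ * (t + t / (t + b)) = t * xi_ + xi_ * t / (t + b) by ring.
rewrite -lerBrDl ler_pdivrMr //.
have := ler_wpM2r (ltW t0) h5.
have -> : (1 + b / t) * (1 - t * xi_) * t = (1 - t * xi_) * (t + b).
  by field; rewrite gt_eqF.
by [].
Qed.

End Gram.

(** * The product over several copies *)

Section PencilProduct.
Variables (R : rcfType) (n r : nat) (H : 'M[R[i]]_n).
Local Notation D := (pencil_det H).
Local Notation J := ('I_n * 'I_r)%type.
Hypothesis herm : ctr H = H.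

Definition slice (T : {set J}) (l : 'I_r) : {set 'I_n} := [set i | (i, l) \in T].

Definition pencil_prod (T : {set J}) (w : J -> R) : R :=
  \prod_(l < r) D (slice T l) (fun i => w (i, l)).

Lemma pencil_prodE T w l : pencil_prod T w
  = D (slice T l) (fun i => w (i, l))
    * \prod_(k < r | k != l) D (slice T k) (fun i => w (i, k)).
Proof. by rewrite /pencil_prod (bigD1 l). Qed.

Lemma upd_slice (w : J -> R) i l t :
  (fun a => upd w (i, l) t (a, l)) = upd (fun a => w (a, l)) i t.
Proof.
by apply/funext => a; rewrite /upd xpair_eqE eqxx andbT.
Qed.

Lemma pencil_prod_upd T w i l t : pencil_prod T (upd w (i, l) t)
  = D (slice T l) (upd (fun a => w (a, l)) i t)
    * \prod_(k < r | k != l) D (slice T k) (fun a => w (a, k)).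
Proof.
rewrite (pencil_prodE _ _ l) upd_slice; congr (_ * _).
apply: eq_bigr => k kl; congr (D _ _); apply/funext => a.
by rewrite /upd xpair_eqE (negPf kl) andbF.
Qed.

Lemma pd_pencil_prodE T w i l : pd (i, l) (pencil_prod T) w
  = pd i (D (slice T l)) (fun a => w (a, l))
    * \prod_(k < r | k != l) D (slice T k) (fun a => w (a, k)).
Proof. by rewrite /pd !pencil_prod_upd -mulrBl. Qed.

Lemma multiaffine_pencil_prod T : multiaffine (pencil_prod T).
Proof.
move=> [i l] w t; rewrite !pencil_prod_upd (multiaffine_pencil_det H (slice T l) i).
by rewrite mulrDl pd_pencil_prodE mulrA.
Qed.

Lemma pd_pencil_prod T i l : pd (i, l) (pencil_prod T)
  = if (i, l) \in T then fun=> 0 else pencil_prod ((i, l) |: T).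
Proof.
apply/funext => w; rewrite pd_pencil_prodE pd_pencil_det inE.
case: ifP => // ilT; first by rewrite mul0r.
rewrite (pencil_prodE _ _ l); congr (D _ _ * _).
  by apply/setP => a; rewrite !inE xpair_eqE eqxx andbT.
apply: eq_bigr => k kl; congr (D _ _); apply/setP => a.
by rewrite !inE xpair_eqE (negPf kl) andbF.
Qed.

Lemma pds_pencil_prod T : pds T (pencil_prod set0) = pencil_prod T.
Proof.
elim/set_ind_U1: T => [|[i l] T iT IH]; first by rewrite pds0.
by rewrite pdsU1 // IH pd_pencil_prod (negPf iT).
Qed.

(** For two variables in the same copy, the inequality is that of one factor times the square of the
    others; for variables in different copies it is an equality. *)
Lemma mstable_pencil_prod w0 : D set0 w0 != 0 -> mstable (pencil_prod set0).
Proof.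
move=> d0; have [_ rD] := mstable_pencil_det herm d0.
split=> [|[i l] [j k] w ijkl]; first exact: multiaffine_pencil_prod.
pose A := fun w : J -> R => D set0 (fun a => w (a, l)).
pose B := fun w : J -> R => \prod_(m < r | m != l) D set0 (fun a => w (a, m)).
have PE : pencil_prod set0 = fun w => A w * B w.
  have slice0 m : slice set0 m = set0 by apply/setP => a; rewrite !inE.
  apply/funext => w'; rewrite (pencil_prodE _ _ l) slice0; congr (_ * _).
  by apply: eq_bigr => m _; rewrite slice0.
have Bl a w' t : B (upd w' (a, l) t) = B w'.
  apply: eq_bigr => m ml; congr (D _ _); apply/funext => b.
  by rewrite /upd xpair_eqE (negPf ml) andbF.
have pdA a : pd (a, l) A = fun w' => pd a (D set0) (fun b => w' (b, l)).
  by apply/funext => w'; rewrite /pd /A !upd_slice.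
have pdAB F a w' : pd (a, l) (fun w => F w * B w) w' = pd (a, l) F w' * B w'.
  by rewrite /pd !Bl mulrBl.
have [kl|kl] := eqVneq k l.
  subst k; have ij : i != j by apply: contraNneq ijkl => ->.
  have e a : pd (a, l) (fun w => A w * B w) = fun w => pd (a, l) A w * B w.
    by apply/funext => w'; apply: pdAB.
  rewrite PE !e pdAB pdA.
  have -> : pd (i, l) (fun w' => pd j (D set0) (fun b => w' (b, l))) w
     = pd i (pd j (D set0)) (fun b => w (b, l)).
    by rewrite /pd !upd_slice.
  rewrite pdA mulrACA [leRHS]mulrACA; apply: ler_wpM2r; first by rewrite -expr2 sqr_ge0.
  exact: rD.
have Ak w' t : A (upd w' (j, k) t) = A w'.
  congr (D _ _); apply/funext => b.
  by rewrite /upd xpair_eqE (eq_sym l) (negPf kl) andbF.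
have ejk : pd (j, k) (fun w => A w * B w) = fun w => A w * pd (j, k) B w.
  by apply/funext => w'; rewrite /pd !Ak mulrBr.
have BB : pd (i, l) (fun w => A w * pd (j, k) B w) w = pd (i, l) A w * pd (j, k) B w.
  have lk : (i, l) != (j, k) by rewrite xpair_eqE (eq_sym l) (negPf kl) andbF.
  by rewrite /pd !(updC _ _ _ lk) !Bl mulrBl.
by rewrite PE ejk BB pdAB le_eqVlt; apply/orP; left; apply/eqP; ring.
Qed.

End PencilProduct.

(** * The paving *)

Section OperatorNorm.
Variables (R : realType) (n : nat).
Local Notation C := R[i].
Local Notation RtoC := (real_complex R).
Implicit Types (T : 'M[C]_n) (v x : 'cV[C]_n).

Lemma sqr_l2norm v : l2norm v ^+ 2 = sqnorm v.
Proof. by rewrite /l2norm sqr_sqrtr // sqnorm_ge0. Qed.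

Lemma l2norm_ge0 v : 0 <= l2norm v.
Proof. exact: sqrtr_ge0. Qed.

Lemma normc_ge0 (z : C) : 0 <= Normc.normc z.
Proof. by case: z => a b; apply: sqrtr_ge0. Qed.

Lemma normc_sum_le (I : Type) (s : seq I) (F : I -> C) :
  Normc.normc (\sum_(k <- s) F k) <= \sum_(k <- s) Normc.normc (F k).
Proof.
elim/big_rec2: _ => [|k x y _ xy]; first by rewrite Normc.normc0.
by apply: le_trans (le_normcD _ _) _; rewrite lerD2l.
Qed.

(** Every coordinate of a vector of the unit ball has modulus at most 1, so the absolute row sums of
    [T] give a bound. *)
Lemma has_ubound_opnorm T :
  has_ubound [set l2norm (T *m x) | x in [set x : 'cV[C]_n | l2norm x <= 1]]%classic.
Proof.
exists (Num.sqrt (\sum_k (\sum_j Normc.normc (T k j)) ^+ 2)) => _ [x /= x1 <-].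
apply: ler_wsqrtr; apply: ler_sum => k _.
have xk j : Normc.normc (x j 0) <= 1.
  have : Normc.normc (x j 0) ^+ 2 <= 1.
    apply: le_trans (_ : sqnorm x <= 1); last first.
      by rewrite -sqr_l2norm exprn_ile1 // l2norm_ge0.
    by rewrite /sqnorm (bigD1 j) //= lerDl sumr_ge0 // => a _; rewrite sqr_ge0.
  by rewrite -[X in _ <= X -> _](expr1n _ 2) ler_sqr ?nnegrE ?normc_ge0.
rewrite ler_sqr ?nnegrE ?normc_ge0 ?sumr_ge0 // => [|j _]; last exact: normc_ge0.
rewrite mxE; apply: le_trans (normc_sum_le _ _) _; apply: ler_sum => j _.
by rewrite Normc.normcM ler_piMr // normc_ge0.
Qed.

Lemma sqnorm_le_opnorm T (B : R) v : opnorm T <= B ->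
  sqnorm (T *m v) <= B ^+ 2 * sqnorm v.
Proof.
move=> TB; have [v0|v0] := eqVneq (sqnorm v) 0.
  by rewrite v0 mulr0 (sqnorm_eq0 v0) mulmx0 /sqnorm big1 // => k _;
    rewrite mxE Normc.normc0 expr0n.
have vp : 0 < sqnorm v by rewrite lt_neqAle eq_sym v0 sqnorm_ge0.
pose s := l2norm v; have sp : 0 < s by rewrite sqrtr_gt0.
have s2 : s ^+ 2 = sqnorm v by apply: sqr_l2norm.
have normV : Normc.normc (RtoC s^-1) ^+ 2 = (sqnorm v)^-1.
  by rewrite sqr_normcE /= expr0n addr0 exprVn s2.
have x1 : l2norm (RtoC s^-1 *: v) <= 1.
  by rewrite -(expr_le1 (n := 2)) // ?l2norm_ge0 // sqr_l2norm sqnormZ normV mulVf.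
have : l2norm (T *m (RtoC s^-1 *: v)) <= B.
  by apply: le_trans TB; apply: ub_le_sup (has_ubound_opnorm T) _ _; exists (RtoC s^-1 *: v).
move=> /(fun h => ler_pM (l2norm_ge0 _) (l2norm_ge0 _) h h).
rewrite -!expr2 sqr_l2norm -scalemxAr sqnormZ normV mulrC ler_pdivrMr //.
Qed.

End OperatorNorm.

(* S may contain several copies of the same index: only the existence of one
   copy is needed. *)
Lemma gram_paving (R : rcfType) (n r : nat) (T : 'M[R[i]]_n) (b t : R) :
  0 < b -> 0 < t ->
  (forall v : 'cV_n, sqnorm (T *m v) <= b * sqnorm v) ->
  (forall i, sqnorm (T *m delta_mx i (0 : 'I_1)) = 1) ->
  exists S : {set 'I_n * 'I_r.+1},
    (forall i, exists l, (i, l) \in S) /\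
    forall l (v : 'cV_n), (forall i, (i, l) \notin S -> v i 0 = 0) ->
      ((r%:R / r.+1%:R) ^+ 2 * (t + t / (t + b)) - t) * sqnorm v <= sqnorm (T *m v).
Proof.
move=> b0 t0 Tb T1.
pose H := ctr T *m T; pose f := pencil_prod (r := r.+1) H set0.
have herm : ctr H = H by apply: ctr_gram.
pose alpha := (t + t / (t + b))^-1.
have a0 : 0 < alpha by rewrite invr_gt0 addr_gt0 // divr_gt0 // addr_gt0.
pose x : 'I_n * 'I_r.+1 -> R := fun=> t.
have D0 S : 0 < pencil_det H S (fun=> t) by apply: det_gram_pencil_gt0.
have sf : mstable f.
  by apply: mstable_pencil_prod herm (fun=> t) _; rewrite gt_eqF.
have Hf : above [set: 'I_n * 'I_r.+1] f x.
  by move=> S _; rewrite /f pds_pencil_prod /pencil_prod prodr_gt0.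
have bar i l : barrier (i, l) f x <= alpha.
  rewrite /barrier /f pd_pencil_prodE (pencil_prodE _ _ _ l) -mulf_div divff; last first.
    by rewrite gt_eqF // prodr_gt0.
  have -> : slice set0 l = set0 :> {set 'I_n} by apply/setP => a; rewrite !inE.
  by rewrite mulr1 pd_pencil_det inE setU0; apply: gram_barrier.
have [|S [_ HS _ Sin]] := @select_groups R _ r (enum 'I_n) f [set: _] x alpha t
  (enum_uniq _) sf Hf a0; first by move=> i l _; rewrite inE.
exists S; split=> [i|l v vS]; first by apply: Sin; rewrite mem_enum.
set c := t - (r%:R / r.+1%:R) ^+ 2 / alpha in HS.
have cE : (r%:R / r.+1%:R) ^+ 2 * (t + t / (t + b)) - t = - c.
  by rewrite /c /alpha invrK; ring.
pose T0 := [set i | (i, l) \notin S].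
have minors (T' : {set 'I_n}) : T0 \subset T' -> 0 < pencil_det H T' (fun=> c).
  move=> sT.
  (* Deriving along [A] exhausts every copy but [l], whose factor becomes 1, and leaves the minor
     for [T'] in copy [l]. All of the complement of [S] lies in [A]. *)
  pose A := [set p : 'I_n * 'I_r.+1 | (p.2 != l) || (p.1 \in T')].
  have := HS (A :&: S) (subsetIr _ _).
  rewrite -pdsU; last first.
    rewrite -setI_eq0; apply/eqP/setP => p; rewrite !inE.
    by case: (p \in S); rewrite ?andbF.
  have -> : A :&: S :|: [set: _] :\: S = A.
    apply/setP => -[i k]; rewrite !inE /=; case: (boolP ((i, k) \in S)) => ikS.
      by rewrite andbT orbF.
    rewrite andbF /=; case: eqVneq => //= kl; apply/esym/(subsetP sT).
    by rewrite inE -kl.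
  rewrite /f pds_pencil_prod (pencil_prodE _ _ _ l) big1 => [|k kl]; last first.
    have -> : slice A k = [set: 'I_n] by apply/setP => i; rewrite !inE kl.
    exact: pencil_detT.
  have -> : slice A l = T' by apply/setP => i; rewrite !inE eqxx.
  rewrite mulr1; congr (0 < pencil_det _ _ _).
  by apply/funext => i; rewrite mem_enum.
have vT0 i : i \in T0 -> v i 0 = 0 by rewrite inE; apply: vS.
(* Sylvester's criterion gives [0 <= c * sqnorm v + sqnorm (T *m v)]. *)
have := pencil_form_ge0 herm minors vT0.
rewrite gram_form ler0c -mulr_sumr -/(sqnorm v) cE mulNr; lra.
Qed.

Theorem mainTheorem3 (R : realType) (B : R) (hB : 1 < B) :
  exists r : nat,
    forall (n : nat) (T : 'M[R[i]]_n),
      (forall i : 'I_n, l2norm (T *m basis_vec i) = 1) ->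
      opnorm T <= B ->
      exists A : 'I_r -> {set 'I_n},
        is_partition_family A
        /\ forall (j : 'I_r) (a : 'I_n -> R[i]),
             7 / 16 * (\sum_(i in A j) Normc.normc (a i) ^+ 2)
             <= l2norm (\sum_(i in A j) a i *: (T *m basis_vec i)) ^+ 2.
Proof.
pose b := B ^+ 2; have b1 : 1 < b by rewrite exprn_egt1 // ltW.
have b0 : 0 < b by apply: lt_trans b1.
(* With [t = 8 * b] one has [t / (t + b) = 8 / 9]. Taking [N >= 100 * b] copies keeps the loss,
   about [16 * b / N], small enough to stay above 7/16. *)
pose r := Num.bound (100 * b); pose N : R := r.+1%:R.
have Nb : 100 * b <= N.
  have b100 : 0 <= 100 * b by rewrite mulr_ge0 // ltW.
  by apply: le_trans (ltW (archi_boundP b100)) _; rewrite ler_nat leqnSn.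
exists r.+1 => n T T1 TB.
have T1' i : sqnorm (T *m delta_mx i (0 : 'I_1)) = 1.
  by rewrite -sqr_l2norm T1 expr1n.
have t0 : 0 < 8 * b by rewrite mulr_gt0.
have [S [Sin HS]] := gram_paving r b0 t0 (fun v => sqnorm_le_opnorm v TB) T1'.
(* Keeping a single selected copy of each index makes the blocks disjoint. *)
have [ch chS] : exists ch : 'I_n -> 'I_r.+1, forall i, (i, ch i) \in S.
  by exists (fun i => xchoose (Sin i)) => i; apply: (xchooseP (Sin i)).
exists (fun j => [set i | ch i == j]); split.
  split=> [|j k jk].
    by apply/setP => i; rewrite inE; apply/bigcupP; exists (ch i); rewrite ?inE.
  rewrite -setI_eq0; apply/eqP/setP => i; rewrite !inE.
  by case: eqP => //= ->; rewrite (negPf jk).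
move=> j a; set Aj := [set i | ch i == j].
pose v : 'cV[R[i]]_n := \col_i (if i \in Aj then a i else 0).
have vS i : (i, j) \notin S -> v i 0 = 0.
  move=> ijS; rewrite mxE inE; case: eqP => // ij.
  by move: (chS i); rewrite ij (negPf ijS).
have := HS j v vS.
have -> : T *m v = \sum_(i in Aj) a i *: (T *m basis_vec i).
  have -> : v = \sum_(i in Aj) a i *: basis_vec i.
    apply/matrixP => k l; rewrite ord1 mxE summxE big_mkcond (bigD1 k) //= big1.
      by rewrite addr0; case: ifP => // _; rewrite !mxE !eqxx mulr1.
    by move=> i ik; case: ifP => // _; rewrite !mxE eq_sym (negPf ik) mulr0.
  by rewrite mulmx_sumr; apply: eq_bigr => i _; rewrite -scalemxAr.
have -> : sqnorm v = \sum_(i in Aj) Normc.normc (a i) ^+ 2.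
  rewrite /sqnorm [RHS]big_mkcond; apply: eq_bigr => i _; rewrite mxE.
  by case: ifP => // _; rewrite Normc.normc0 expr0n.
rewrite sqr_l2norm => h; apply: le_trans h; apply: ler_wpM2r.
  by apply: sumr_ge0 => i _; apply: sqr_ge0.
have N0 : 0 < N by rewrite ltr0n.
have -> : 8 * b / (8 * b + b) = 8 / 9.
  by field; rewrite gt_eqF // addr_gt0.
have -> : r%:R / r.+1%:R = 1 - N^-1.
  by rewrite -[X in X%:R / _]/(r.+1.-1) -subn1 natrB // mulrBl divff ?gt_eqF // mul1r.
have q0 : 0 <= N^-1 by rewrite invr_ge0 ltW.
have q1 : 100 * b * N^-1 <= 1 by rewrite ler_pdivrMr ?mul1r.
(* Since [b > 1], the term [16 / 9 * N^-1] of the loss is also bounded through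
   [N^-1 <= b * N^-1 <= 1 / 100]. *)
have q2 : 0 <= N^-1 * (b - 1) by rewrite mulr_ge0 // subr_ge0 ltW.
have q3 : (1 - 2 * N^-1) * (8 * b + 8 / 9) <= (1 - N^-1) ^+ 2 * (8 * b + 8 / 9).
  apply: ler_wpM2r; first by lra.
  by rewrite -subr_ge0 (_ : _ - _ = N^-1 ^+ 2) ?sqr_ge0 //; ring.
move: (N^-1) q0 q1 q2 q3 => q q0 q1 q2 q3; nra.
Qed.
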